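(* Let $\hat{\boldsymbol{\Phi}}_{yy},\hat{\boldsymbol{\Phi}}_{uy},\hat{\boldsymbol{\Phi}}_{yu},\hat{\boldsymbol{\Phi}}_{uu}\in\mathcal{RH}_\infty$ satisfy $$\begin{bmatrix}I&-\mathbf{G}\end{bmatrix}\begin{bmatrix}\hat{\boldsymbol{\Phi}}_{yy}&\hat{\boldsymbol{\Phi}}_{yu}\\ \hat{\boldsymbol{\Phi}}_{uy}&\hat{\boldsymbol{\Phi}}_{uu}\end{bmatrix}=\begin{bmatrix}I+\boldsymbol{\Delta}_1&\boldsymbol{\Delta}_2\end{bmatrix},\qquad \begin{bmatrix}\hat{\boldsymbol{\Phi}}_{yy}&\hat{\boldsymbol{\Phi}}_{yu}\\ \hat{\boldsymbol{\Phi}}_{uy}&\hat{\boldsymbol{\Phi}}_{uu}\end{bmatrix}\begin{bmatrix}-\mathbf{G}\\ I\end{bmatrix}=\begin{bmatrix}\boldsymbol{\Delta}_3\\ I+\boldsymbol{\Delta}_4\end{bmatrix},$$ where $\boldsymbol{\Delta}_1,\dots,\boldsymbol{\Delta}_4$ are the residuals. Then - for open-loop stable plants, the controller $\mathbf{K}=\hat{\boldsymbol{\Phi}}_{uy}\hat{\boldsymbol{\Phi}}_{yy}^{-1}$ internally stabilizes the plant if $\|\boldsymbol{\Delta}_1\|_\infty<1$. Let $\hat{\boldsymbol{\Phi}}_{xx},\hat{\boldsymbol{\Phi}}_{ux},\hat{\boldsymbol{\Phi}}_{xy},\hat{\boldsymbol{\Phi}}_{uy}\in\mathcal{RH}_\infty$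 satisfy $$\begin{bmatrix}zI-A&-B\end{bmatrix}\begin{bmatrix}\hat{\boldsymbol{\Phi}}_{xx}&\hat{\boldsymbol{\Phi}}_{xy}\\ \hat{\boldsymbol{\Phi}}_{ux}&\hat{\boldsymbol{\Phi}}_{uy}\end{bmatrix}=\begin{bmatrix}I+\hat{\boldsymbol{\Delta}}_1&\hat{\boldsymbol{\Delta}}_2\end{bmatrix},\qquad \begin{bmatrix}\hat{\boldsymbol{\Phi}}_{xx}&\hat{\boldsymbol{\Phi}}_{xy}\\ \hat{\boldsymbol{\Phi}}_{ux}&\hat{\boldsymbol{\Phi}}_{uy}\end{bmatrix}\begin{bmatrix}zI-A\\-C\end{bmatrix}=\begin{bmatrix}I+\hat{\boldsymbol{\Delta}}_3\\ \hat{\boldsymbol{\Delta}}_4\end{bmatrix},$$ where $\hat{\boldsymbol{\Delta}}_1,\dots,\hat{\boldsymbol{\Delta}}_4$ are the residuals. Then - for the state feedback case ($C=I$), the controller $\mathbf{K}=\hat{\boldsymbol{\Phi}}_{ux}\hat{\boldsymbol{\Phi}}_{xx}^{-1}$ internally stabilizes the plant if $\|\hat{\boldsymbol{\Delta}}_1\|_\infty<1$; - for open-loop stable plants, the controller $\mathbf{K}=\hat{\boldsymbol{\Phi}}_{uy}(I+C\hat{\boldsymbol{\Phi}}_{xy})^{-1}$ internally stabilizes the plant if $$\|\hat{\boldsymbol{\Delta}}_2\|_\infty\leq\frac{1}{\|C(zI-A)^{-1}\|_\infty}.$$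
   Context: Plant (discrete-time LTI, strictly proper, real matrices): $x[t+1]=Ax[t]+Bu[t]+\delta_x[t]$, $y[t]=Cx[t]+\delta_y[t]$, with transfer matrix $\mathbf{G}=C(zI-A)^{-1}B$; it is open-loop stable if $A$ is stable (all eigenvalues of modulus less than $1$). Controller: $\mathbf{u}=\mathbf{K}\mathbf{y}+\boldsymbol{\delta}_u$ with realization $\xi[t+1]=A_k\xi[t]+B_ky[t]$, $u[t]=C_k\xi[t]+D_ky[t]+\delta_u[t]$, i.e. $\mathbf{K}=C_k(zI-A_k)^{-1}B_k+D_k$. Standing assumption: $(A,B)$ and $(A_k,B_k)$ are stabilizable, $(A,C)$ and $(A_k,C_k)$ are detectable. $\mathbf{K}$ internally stabilizes $\mathbf{G}$ if the closed-loop system is well-posed and $(x[t],\xi[t])\to0$ as $t\to\infty$ for all initial states when $\delta_x,\delta_y,\delta_u$ vanish identically. $\mathcal{RH}_\infty$ is the set of real-rational proper stable transfer matrices (all poles of modulus less than $1$); for $\mathbf{H}\in\mathcal{RH}_\infty$, $\|\mathbf{H}\|_\infty=\sup_\omega\sigma_{\max}(\mathbf{H}(e^{j\omega}))$, with $\sigma_{\max}$ the maximum singular value.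
   Formalization: The last bound is taken strict (< instead of ≤), since the claim fails at equality; in the state feedback case Φ̂xx is assumed invertible and K=Φ̂uxΦ̂xx⁻¹ proper, since otherwise K need not be a controller; Δ̂1 and Δ̂2 are assumed in RH∞ where their norms are bounded. *)

(* Defs.v *)
(* MathComp and MathComp-Analysis, over an arbitrary R : realType. *)
From HB Require Import structures.
From mathcomp Require Import all_boot all_order all_algebra.
From mathcomp Require Import spectral fraction complex.
From mathcomp Require Import all_classical all_reals all_analysis.

Set Implicit Arguments.
Unset Strict Implicit.
Unset Printing Implicit Defensive.

Import Order.TTheory GRing.Theory Num.Theory.
Import numFieldNormedType.Exports.

Local Open Scope classical_set_scope.
Local Open Scope ring_scope.
Local Open Scope complex_scope.
Local Open Scope sesquilinear_scope.

(* The field R(z) of real rational functions; transfer matrices are matrices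
   over it. *)
Notation ratfun R := {fraction {poly R}}.

Section RationalFunctions.
Variable R : realType.
Implicit Type f : ratfun R.

(* Numerator and denominator in lowest terms (up to a common unit): 'repr'
   returns some representative fraction, not a reduced one. *)
Definition numr f : {poly R} :=
  let r := repr f in (frac r).1 %/ gcdp (frac r).1 (frac r).2.
Definition denr f : {poly R} :=
  let r := repr f in (frac r).2 %/ gcdp (frac r).1 (frac r).2.

Definition rf_proper f : Prop := (size (numr f) <= size (denr f))%N.

Definition rf_pole f (z : R[i]) : Prop := root (map_poly (real_complex R) (denr f)) z.

(* Meaningful when z is not a pole of f. *)
Definition rf_eval f (z : R[i]) : R[i] :=
  (map_poly (real_complex R) (numr f)).[z] / (map_poly (real_complex R) (denr f)).[z].

End RationalFunctions.

Section TransferMatrices.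
Variable R : realType.

Definition proper_mx p q (H : 'M[ratfun R]_(p, q)) : Prop :=
  forall i j, rf_proper (H i j).

Definition RHinf p q (H : 'M[ratfun R]_(p, q)) : Prop :=
  proper_mx H /\ (forall i j (z : R[i]), rf_pole (H i j) z -> `|z| < 1).

Definition singular_values p q (M : 'M[R[i]]_(p, q)) : set R :=
  [set s : R | 0 <= s /\ eigenvalue (M ^t* *m M) ((s ^+ 2)%:C)].

(* A supremum over a finite set, hence a maximum; it is 0 if q = 0. *)
Definition sigma_max p q (M : 'M[R[i]]_(p, q)) : R := sup (singular_values M).

(* Meaningful on RHinf. *)
Definition hinf_norm p q (H : 'M[ratfun R]_(p, q)) : \bar R :=
  ereal_sup [set (sigma_max (map_mx (fun f => rf_eval f (cos w +i* sin w)) H))%:E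
            | w in [set: R]].

Definition rf_mx p q (M : 'M[R]_(p, q)) : 'M[ratfun R]_(p, q) :=
  map_mx (fun a => tofrac a%:P) M.

(* zI - A *)
Definition zIsub n (A : 'M[R]_n) : 'M[ratfun R]_n :=
  map_mx (@tofrac _) (char_poly_mx A).

(* C (zI - A)^-1 B + D *)
Definition transfer n m p (A : 'M[R]_n) (B : 'M[R]_(n, m)) (C : 'M[R]_(p, n))
    (D : 'M[R]_(p, m)) : 'M[ratfun R]_(p, m) :=
  rf_mx C *m invmx (zIsub A) *m rf_mx B + rf_mx D.

Definition iop_residuals p m (G : 'M[ratfun R]_(p, m))
    (Fyy : 'M[ratfun R]_(p, p)) (Fyu : 'M[ratfun R]_(p, m))
    (Fuy : 'M[ratfun R]_(m, p)) (Fuu : 'M[ratfun R]_(m, m))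
    (D1 : 'M[ratfun R]_(p, p)) (D2 : 'M[ratfun R]_(p, m))
    (D3 : 'M[ratfun R]_(p, m)) (D4 : 'M[ratfun R]_(m, m)) : Prop :=
  row_mx 1%:M (- G) *m block_mx Fyy Fyu Fuy Fuu = row_mx (1%:M + D1) D2 /\
  block_mx Fyy Fyu Fuy Fuu *m col_mx (- G) 1%:M = col_mx D3 (1%:M + D4).

Definition slp_residuals n m p
    (A : 'M[R]_n) (B : 'M[R]_(n, m)) (C : 'M[R]_(p, n))
    (Fxx : 'M[ratfun R]_(n, n)) (Fxy : 'M[ratfun R]_(n, p))
    (Fux : 'M[ratfun R]_(m, n)) (Fuy : 'M[ratfun R]_(m, p))
    (D1 : 'M[ratfun R]_(n, n)) (D2 : 'M[ratfun R]_(n, p))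
    (D3 : 'M[ratfun R]_(n, n)) (D4 : 'M[ratfun R]_(m, n)) : Prop :=
  row_mx (zIsub A) (- rf_mx B) *m block_mx Fxx Fxy Fux Fuy
    = row_mx (1%:M + D1) D2 /\
  block_mx Fxx Fxy Fux Fuy *m col_mx (zIsub A) (- rf_mx C)
    = col_mx (1%:M + D3) D4.

End TransferMatrices.

Section StateSpace.
Variable R : realType.

Definition stable_mx n (A : 'M[R]_n) : Prop :=
  forall l : R[i], eigenvalue (map_mx (real_complex R) A) l -> `|l| < 1.

Definition stabilizable n m (A : 'M[R]_n) (B : 'M[R]_(n, m)) : Prop :=
  exists F : 'M[R]_(m, n), stable_mx (A + B *m F).

Definition detectable n p (A : 'M[R]_n) (C : 'M[R]_(p, n)) : Prop :=
  exists L : 'M[R]_(n, p), stable_mx (A + L *m C).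

Definition closed_loop n m p k
    (A : 'M[R]_n) (B : 'M[R]_(n, m)) (C : 'M[R]_(p, n))
    (Ak : 'M[R]_k) (Bk : 'M[R]_(k, p)) (Ck : 'M[R]_(m, k)) (Dk : 'M[R]_(m, p))
    (dx : nat -> 'cV[R]_n) (dy : nat -> 'cV[R]_p) (du : nat -> 'cV[R]_m)
    (x : nat -> 'cV[R]_n) (y : nat -> 'cV[R]_p)
    (xi : nat -> 'cV[R]_k) (u : nat -> 'cV[R]_m) : Prop :=
  forall t : nat,
    [/\ x t.+1 = A *m x t + B *m u t + dx t,
        y t = C *m x t + dy t,
        xi t.+1 = Ak *m xi t + Bk *m y t &
        u t = Ck *m xi t + Dk *m y t + du t].

Definition well_posed n m p k
    (A : 'M[R]_n) (B : 'M[R]_(n, m)) (C : 'M[R]_(p, n))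
    (Ak : 'M[R]_k) (Bk : 'M[R]_(k, p)) (Ck : 'M[R]_(m, k)) (Dk : 'M[R]_(m, p)) :
    Prop :=
  forall (x0 : 'cV[R]_n) (xi0 : 'cV[R]_k)
      (dx : nat -> 'cV[R]_n) (dy : nat -> 'cV[R]_p) (du : nat -> 'cV[R]_m),
  exists! s : (nat -> 'cV[R]_n) * (nat -> 'cV[R]_p) *
              (nat -> 'cV[R]_k) * (nat -> 'cV[R]_m),
    let: (x, y, xi, u) := s in
    [/\ x 0%N = x0, xi 0%N = xi0
      & closed_loop A B C Ak Bk Ck Dk dx dy du x y xi u].

Definition asymptotically_stable n m p k
    (A : 'M[R]_n) (B : 'M[R]_(n, m)) (C : 'M[R]_(p, n))
    (Ak : 'M[R]_k) (Bk : 'M[R]_(k, p)) (Ck : 'M[R]_(m, k)) (Dk : 'M[R]_(m, p)) :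
    Prop :=
  forall x y xi u,
    closed_loop A B C Ak Bk Ck Dk (fun=> 0) (fun=> 0) (fun=> 0) x y xi u ->
    x @ \oo --> (0 : 'cV[R]_n) /\ xi @ \oo --> (0 : 'cV[R]_k).

(* The controller K (a proper transfer matrix) internally stabilizes the plant
   (A, B, C), through any of its stabilizable and detectable realizations. *)
Definition internally_stabilizes n m p
    (A : 'M[R]_n) (B : 'M[R]_(n, m)) (C : 'M[R]_(p, n))
    (K : 'M[ratfun R]_(m, p)) : Prop :=
  proper_mx K /\
  forall k (Ak : 'M[R]_k) (Bk : 'M[R]_(k, p)) (Ck : 'M[R]_(m, k))
      (Dk : 'M[R]_(m, p)),
    stabilizable Ak Bk -> detectable Ak Ck -> transfer Ak Bk Ck Dk = K ->
    well_posed A B C Ak Bk Ck Dk /\ asymptotically_stable A B C Ak Bk Ck Dk.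

End StateSpace.

(* Main.v *)
(* Every rational function is read through its values at the points of the exterior
   |z| >= 1 together with infinity; membership in RH_oo is the existence of all
   these values.  If D is in RH_oo with |D| <= r < 1 on the unit circle, the maximum
   principle applied to u D u^* shows that I + D is invertible at every exterior
   point, hence invertible in RH_oo.  In the three cases the residual equation
   exhibits (I - GK)^-1 as Fyy (I + D1)^-1, Fxx (I + D1)^-1 (zI - A) and, with
   D = C (zI - A)^-1 D2, as (I + C Fxy) (I + D)^-1, from which the four closed-loop
   maps are stable.  Stabilizability and detectability of the realizations then give
   the stability of the closed-loop matrix, whose powers converge to 0. *)
Require Import Defs.
From HB Require Import structures.
From mathcomp Require Import all_boot all_order all_algebra.
From mathcomp Require Import spectral fraction complex.
From mathcomp Require Import cyclic separable cyclotomic.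
From mathcomp Require Import zify ring lra.
From mathcomp Require Import all_classical all_reals all_analysis.

Set Implicit Arguments.
Unset Strict Implicit.
Unset Printing Implicit Defensive.

Import Order.TTheory GRing.Theory Num.Theory.
Local Open Scope ring_scope.

(** * Values of rational functions at the points of the projective line *)

(** The maximum principle is needed only for rational functions, so analytic function theory gives
    way to algebra: averages over roots of unity bound coefficients, powers of the polynomial remove
    the number of terms, and a polynomial cofactor clears the denominator. For matrices, if the
    value of I + D at a point is singular, it supplies a row vector u that is then kept constant in
    z, and u D u^* is a scalar rational function, with complex coefficients although D is real.
    Infinity counts as an exterior point because the formula for K hides two claims: its denominator
    is invertible, and K is proper. For a stable plant both hold because G vanishes at infinity,
    where the denominator equals I plus the residual. In state feedback zI - A has a pole at
    infinity, and both claims are hypotheses. For the closed loop finite points suffice, since every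
    resolvent is proper: plant and controller side by side are one block-diagonal system under
    constant feedback. *)

Section Places.
Variable R : realType.
Implicit Types (p q d : {poly R}) (f g : ratfun R) (a : option R[i]).

(* Value at [a] of the degree-[m] homogenization of [p]; [None] is the point at
   infinity. *)
Definition heval (a : option R[i]) (m : nat) (p : {poly R[i]}) : R[i] :=
  if a is Some z then p.[z] else p`_m.

Local Notation toC := (map_poly (real_complex R)).

Lemma hevalD a m (p q : {poly R[i]}) :
  heval a m (p + q) = heval a m p + heval a m q.
Proof. by case: a => [z|] /=; rewrite ?hornerD ?coefD. Qed.

Lemma hevalN a m (p : {poly R[i]}) : heval a m (- p) = - heval a m p.
Proof. by case: a => [z|] /=; rewrite ?hornerN ?coefN. Qed.

Lemma coefM_top m m' (p q : {poly R[i]}) :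
  (size p <= m.+1)%N -> (size q <= m'.+1)%N -> (p * q)`_(m + m') = p`_m * q`_m'.
Proof.
move=> sp sq; rewrite coefM (bigD1 (inord m)) //= inordK ?ltnS ?leq_addr //.
rewrite addKn big1 ?addr0 // => i /eqP ni.
case: (ltngtP i m) => im.
- rewrite [q`__]nth_default ?mulr0 //; apply: leq_trans sq _.
  by rewrite ltn_subRL ltn_add2r.
- by rewrite nth_default ?mul0r // (leq_trans sp).
- by case: ni; apply: val_inj; rewrite /= inordK ?im // ltnS leq_addr.
Qed.

Lemma hevalM a m m' (p q : {poly R[i]}) :
  (size p <= m.+1)%N -> (size q <= m'.+1)%N ->
  heval a (m + m') (p * q) = heval a m p * heval a m' q.
Proof.
by case: a => [z|] sp sq /=; [rewrite hornerM | exact: coefM_top].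
Qed.

Lemma size_mul_leqS (F : nzRingType) m m' (p q : {poly F}) :
  (size p <= m.+1)%N -> (size q <= m'.+1)%N -> (size (p * q)%R <= (m + m').+1)%N.
Proof.
move=> sp sq; apply: leq_trans (size_polyMleq _ _) _.
by rewrite -[(m + m').+1]/((m + m').+2.-1) -!subn1 leq_sub2r // -addnS -addSn leq_add.
Qed.

(* A relation rather than a function: values of sums and products then come from
   arbitrary fractions, whereas the reduced ones behind [rf_eval] do not compose. *)
Definition has_value a f (c : R[i]) : Prop := exists m p d,
  [/\ (size p <= m.+1)%N, (size d <= m.+1)%N, heval a m (toC d) != 0,
      f = tofrac p / tofrac d & c = heval a m (toC p) / heval a m (toC d)].

Lemma toC_neq0 a m d : heval a m (toC d) != 0 -> tofrac d != 0.
Proof.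
apply: contraNneq => /eqP; rewrite tofrac_eq0 => /eqP ->.
by rewrite rmorph0; case: a => [z|] /=; rewrite ?horner0 ?coef0.
Qed.

Lemma val_poly z p : has_value (Some z) (tofrac p) (toC p).[z].
Proof.
exists (size p), p, 1; rewrite size_poly1 leqW //; split=> //.
- by rewrite rmorph1 /= hornerC oner_eq0.
- by rewrite tofrac1 divr1.
- by rewrite rmorph1 /= hornerC divr1.
Qed.

Lemma valC a (x : R) : has_value a (tofrac x%:P) x%:C%C.
Proof.
exists 0%N, x%:P, 1; rewrite size_poly1 size_polyC_leq1; split=> //.
- by case: a => [z|]; rewrite rmorph1 /= ?hornerC ?coefC oner_eq0.
- by rewrite tofrac1 divr1.
- case: a => [z|]; rewrite rmorph1 map_polyC /= ?hornerC ?coefC /= ?divr1 //.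
Qed.

Lemma val0 a : has_value a 0 0.
Proof. by have := valC a 0; rewrite tofrac0. Qed.

Lemma val1 a : has_value a 1 1.
Proof. by have := valC a 1; rewrite tofrac1. Qed.

Lemma valN a f c : has_value a f c -> has_value a (- f) (- c).
Proof.
case=> m [p [d [sp sd d0 -> ->]]]; exists m, (- p), d; split=> //.
- by rewrite size_polyN.
- by rewrite tofracN mulNr.
- by rewrite rmorphN hevalN mulNr.
Qed.

Lemma size_toC p m : (size p <= m)%N -> (size (toC p) <= m)%N.
Proof. by rewrite size_map_poly. Qed.

Lemma valD a f g c e :
  has_value a f c -> has_value a g e -> has_value a (f + g) (c + e).
Proof.
case=> m [p [d [sp sd d0 -> ->]]] [m' [p' [d' [sp' sd' d0' -> ->]]]].
have fd := toC_neq0 d0; have fd' := toC_neq0 d0'.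
exists (m + m')%N, (p * d' + p' * d), (d * d'); split.
- rewrite (leq_trans (size_polyD _ _)) // geq_max size_mul_leqS //=.
  by rewrite addnC size_mul_leqS.
- exact: size_mul_leqS.
- by rewrite rmorphM hevalM ?size_toC // mulf_neq0.
- rewrite tofracD (tofracM p) (tofracM p') (tofracM d).
  by rewrite (addf_div (F:=ratfun R) _ _ fd fd').
- rewrite rmorphD !rmorphM /= hevalD ![heval _ _ (_ * toC d')]hevalM ?size_toC //.
  by rewrite [(m + m')%N]addnC hevalM ?size_toC // addf_div.
Qed.

Lemma valB a f g c e :
  has_value a f c -> has_value a g e -> has_value a (f - g) (c - e).
Proof. by move=> vf /valN; apply: valD. Qed.

Lemma valM a f g c e :
  has_value a f c -> has_value a g e -> has_value a (f * g) (c * e).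
Proof.
case=> m [p [d [sp sd d0 -> ->]]] [m' [p' [d' [sp' sd' d0' -> ->]]]].
exists (m + m')%N, (p * p'), (d * d'); rewrite !size_mul_leqS //; split=> //.
- by rewrite rmorphM hevalM ?size_toC // mulf_neq0.
- by rewrite (tofracM p) (tofracM d) (mulf_div (F:=ratfun R)).
- by rewrite !rmorphM /= !hevalM ?size_toC // mulf_div.
Qed.

(** Numerator and denominator carry the same degree bound, so they may be exchanged even at
    infinity. *)
Lemma valV a f c : has_value a f c -> c != 0 -> f != 0 /\ has_value a f^-1 c^-1.
Proof.
case=> m [p [d [sp sd d0 -> ->]]] /[dup] c0; rewrite mulf_eq0 negb_or.
case/andP => p0 _; have fd := toC_neq0 d0; have fp := toC_neq0 p0.
split; first exact: (mulf_neq0 (R:=ratfun R) fp (invr_neq0 (R:=ratfun R) fd)).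
exists m, d, p; split=> //; last by rewrite invf_div.
exact: (invf_div (F:=ratfun R)).
Qed.

(** * Reduced fractions, poles and properness *)

Lemma denr_neq0 f : denr f != 0.
Proof.
rewrite /denr; set r := repr f.
have r2 : (frac r).2 != 0 := denom_ratioP r.
by rewrite dvdp_div_eq0 ?dvdp_gcdr.
Qed.

Lemma fracE f : f = tofrac (frac (repr f)).1 / tofrac (frac (repr f)).2.
Proof.
rewrite -{1}[f]reprK; set r := repr f.
have r2 : (frac r).2 != 0 := denom_ratioP r.
unlock FracField.tofrac; rewrite -[X in _ * X]FracField.pi_inv -[RHS]FracField.pi_mul.
rewrite /FracField.mulf /FracField.invf /= !numden_Ratio ?oner_neq0 //.
by rewrite mulr1 mul1r Ratio_numden.
Qed.

Lemma numr_denrE f : f = tofrac (numr f) / tofrac (denr f).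
Proof.
rewrite {1}[f]fracE /numr /denr; set r := repr f.
have r2 : (frac r).2 != 0 := denom_ratioP r.
set n := (frac r).1; set d := (frac r).2; set g := gcdp n d.
have g0 : tofrac g != 0 by rewrite tofrac_eq0 gcdp_eq0 negb_and r2 orbT.
have nE : tofrac n = tofrac (n %/ g) * tofrac g by rewrite -tofracM divpK ?dvdp_gcdl.
have dE : tofrac d = tofrac (d %/ g) * tofrac g by rewrite -tofracM divpK ?dvdp_gcdr.
rewrite nE dE -(mulf_div (F:=ratfun R)) (divff (F:=ratfun R) g0).
exact: (mulr1 (s:=ratfun R)).
Qed.

Lemma coprime_numr_denr f : coprimep (numr f) (denr f).
Proof.
have r2 : (frac (repr f)).2 != 0 := denom_ratioP (repr f).
by rewrite /numr /denr coprimep_div_gcd // r2 orbT.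
Qed.

Lemma val_cross a m p d f : (size p <= m.+1)%N -> (size d <= m.+1)%N ->
  heval a m (toC d) != 0 -> f = tofrac p / tofrac d ->
  p * denr f = numr f * d.
Proof.
move=> sp sd d0 fE; have fd := toC_neq0 d0.
have fd' : tofrac (denr f) != 0 by rewrite tofrac_eq0 denr_neq0.
apply/eqP; rewrite -tofrac_eq (tofracM p) (tofracM (numr f)).
by rewrite -(eqr_div (F:=ratfun R) _ _ fd fd') -fE -numr_denrE.
Qed.

(** By Gauss's lemma the reduced denominator divides every other denominator d, so a pole at z would
    be a root of d. *)
Lemma val_nopole (z : R[i]) f c : has_value (Some z) f c -> ~ rf_pole f z.
Proof.
case=> m [p [d [sp sd d0 fE _]]]; have crE := val_cross sp sd d0 fE.
have /dvdpP [q dE] : denr f %| d.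
  rewrite -(Gauss_dvdpr d (_ : coprimep (denr f) (numr f))) -?crE ?dvdp_mull //.
  by rewrite coprimep_sym coprime_numr_denr.
by move=> /rootP pole; rewrite dE rmorphM /= hornerM pole mulr0 eqxx in d0.
Qed.

Lemma nopole_val z f : ~ rf_pole f z -> has_value (Some z) f (rf_eval f z).
Proof.
(* Any common bound on the sizes will do: evaluation at a finite point ignores the degree. *)
move=> /negP npole; exists (size (numr f) + size (denr f))%N, (numr f), (denr f).
split=> //; first by rewrite leqW // leq_addr.
- by rewrite leqW // leq_addl.
- exact: numr_denrE.
Qed.

(** The denominator d has a nonzero coefficient of index m, hence degree exactly m, and degrees are
    compared in the cross-multiplied equation. *)
Lemma val_proper f c : has_value None f c -> rf_proper f.
Proof.
case=> m [p [d [sp sd d0 fE _]]]; have crE := val_cross sp sd d0 fE.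
rewrite /rf_proper; have [->|n0] := eqVneq (numr f) 0; first by rewrite size_poly0.
have d0' : d != 0 by have := toC_neq0 d0; rewrite tofrac_eq0.
have sdE : size d = m.+1.
  apply/eqP; rewrite eqn_leq sd /= ltnNge; apply: contra d0 => sd'.
  by rewrite /= nth_default // size_map_poly.
have p0 : p != 0.
  apply: contraNneq n0 => p0; move/eqP: crE.
  by rewrite p0 mul0r eq_sym mulf_eq0 (negPf d0') orbF.
have := congr1 (size \o polyseq) crE; rewrite /= !size_mul ?denr_neq0 // sdE.
have := size_poly_gt0 (denr f); have := size_poly_gt0 (numr f).
rewrite n0 denr_neq0; move: sp.
by move: (size p) (size (numr f)) (size (denr f)) => x y t; lia.
Qed.

Lemma proper_val f : rf_proper f -> exists c, has_value None f c.
Proof.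
rewrite /rf_proper => pf; have d0 := denr_neq0 f.
have sd : size (denr f) = (size (denr f)).-1.+1 by rewrite prednK // size_poly_gt0.
eexists; exists (size (denr f)).-1, (numr f), (denr f); split=> //.
- by rewrite -sd.
- by rewrite -sd.
- by rewrite /= coef_map /= fmorph_eq0 -lead_coefE lead_coef_eq0.
- exact: numr_denrE.
Qed.

(** * Exterior points and values of matrices *)

Definition exterior a : Prop := if a is Some z then 1 <= `|z| else True.

Definition mx_has_value m n a (F : 'M[ratfun R]_(m, n)) (M : 'M[R[i]]_(m, n)) :
  Prop :=
  forall i j, has_value a (F i j) (M i j).
Definition regular m n a (F : 'M[ratfun R]_(m, n)) :
  Prop := exists M, mx_has_value a F M.

Lemma regP m n a (F : 'M[ratfun R]_(m, n)) :
  regular a F <-> forall i j, exists c, has_value a (F i j) c.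
Proof.
split=> [[M FM] i j|]; first by exists (M i j); apply: FM.
move=> /(_ _)/fin_all_exists-/fin_all_exists [M FM].
by exists (\matrix_(i, j) M i j) => i j; rewrite mxE.
Qed.

Lemma RHinfP m n (F : 'M[ratfun R]_(m, n)) :
  RHinf F <-> forall a, exterior a -> regular a F.
Proof.
split=> [[pF sF] [z|] /= az|FR].
- apply/regP => i j; eexists; apply: nopole_val => /sF.
  by rewrite (le_gtF az).
- by apply/regP => i j; apply: proper_val.
- split=> [i j|i j z pz].
  + by have /regP/(_ i j) [c /val_proper] := FR None I.
  + rewrite real_ltNge ?normr_real ?real1 //; apply/negP => z1.
    by have /regP/(_ i j) [c /val_nopole] := FR (Some z) z1.
Qed.

Lemma proper_mxP m n (F : 'M[ratfun R]_(m, n)) : proper_mx F <-> regular None F.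
Proof.
split=> [pF|/regP rF i j].
- by apply/regP => i j; apply: proper_val.
- by have [c /val_proper] := rF i j.
Qed.

Section MatrixValues.
Variable a : option R[i].

Lemma val_sum (I : Type) (r : seq I) (P : pred I) (F : I -> ratfun R) c :
  (forall i, P i -> has_value a (F i) (c i)) ->
  has_value a (\sum_(i <- r | P i) F i) (\sum_(i <- r | P i) c i).
Proof.
move=> Fc; apply: (big_ind2 (has_value a)) => //; first exact: val0.
by move=> x1 x2 y1 y2; exact: valD.
Qed.

Lemma val_prod (I : Type) (r : seq I) (P : pred I) (F : I -> ratfun R) c :
  (forall i, P i -> has_value a (F i) (c i)) ->
  has_value a (\prod_(i <- r | P i) F i) (\prod_(i <- r | P i) c i).
Proof.
move=> Fc; apply: (big_ind2 (has_value a)) => //; first exact: val1.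
by move=> x1 x2 y1 y2; exact: valM.
Qed.

Lemma val_sign n : has_value a ((-1) ^+ n) ((-1) ^+ n).
Proof.
elim: n => [|n IH]; first exact: val1.
by rewrite !exprS; apply: valM => //; apply/valN/val1.
Qed.

Lemma mvalD m n (F G : 'M[ratfun R]_(m, n)) M N :
  mx_has_value a F M -> mx_has_value a G N -> mx_has_value a (F + G) (M + N).
Proof. by move=> FM GN i j; rewrite !mxE; apply: valD. Qed.

Lemma mvalN m n (F : 'M[ratfun R]_(m, n)) M :
  mx_has_value a F M -> mx_has_value a (- F) (- M).
Proof. by move=> FM i j; rewrite !mxE; apply: valN. Qed.

Lemma mvalM (m n p : nat) (F : 'M[ratfun R]_(m, n)) (G : 'M[ratfun R]_(n, p)) M N :
  mx_has_value a F M -> mx_has_value a G N -> mx_has_value a (F *m G) (M *m N).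
Proof. by move=> FM GN i j; rewrite !mxE; apply: val_sum => k _; apply: valM. Qed.

Lemma mval1 n : mx_has_value a (1%:M : 'M[ratfun R]_n) 1%:M.
Proof. by move=> i j; rewrite !mxE; case: eqP => _; [exact: val1 | exact: val0]. Qed.

Lemma mval_rf_mx m n (M : 'M[R]_(m, n)) :
  mx_has_value a (rf_mx M) (map_mx (real_complex R) M).
Proof. by move=> i j; rewrite !mxE; apply: valC. Qed.

Lemma val_det n (F : 'M[ratfun R]_n) M :
  mx_has_value a F M -> has_value a (\det F) (\det M).
Proof.
by move=> FM; apply: val_sum => s _; apply: valM; [exact: val_sign | exact: val_prod].
Qed.

Lemma mval_adj n (F : 'M[ratfun R]_n) M :
  mx_has_value a F M -> mx_has_value a (\adj F) (\adj M).
Proof.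
move=> FM i j; rewrite !mxE; apply: valM; first exact: val_sign.
by apply: val_det => k l; rewrite !mxE.
Qed.

(** Cramer's rule. Invertibility over R(z) follows from invertibility of the value at a single
    point. *)
Lemma mval_inv n (F : 'M[ratfun R]_n) M : mx_has_value a F M -> M \in unitmx ->
  F \in unitmx /\ mx_has_value a (invmx F) (invmx M).
Proof.
move=> FM uM; have dM : \det M != 0 by rewrite -unitfE -unitmxE.
have [dF vd] := valV (val_det FM) dM.
have uF : F \in unitmx by rewrite unitmxE unitfE.
split=> //; rewrite /invmx uF uM => i j; rewrite !mxE.
by apply: valM => //; have := mval_adj FM i j; rewrite !mxE.
Qed.

Lemma regD m n (F G : 'M[ratfun R]_(m, n)) :
  regular a F -> regular a G -> regular a (F + G).
Proof. by move=> [M FM] [N GN]; exists (M + N); apply: mvalD. Qed.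

Lemma regN m n (F : 'M[ratfun R]_(m, n)) : regular a F -> regular a (- F).
Proof. by move=> [M FM]; exists (- M); apply: mvalN. Qed.

Lemma regB m n (F G : 'M[ratfun R]_(m, n)) :
  regular a F -> regular a G -> regular a (F - G).
Proof. by move=> rF /regN; apply: regD. Qed.

Lemma regM (m n p : nat) (F : 'M[ratfun R]_(m, n)) (G : 'M[ratfun R]_(n, p)) :
  regular a F -> regular a G -> regular a (F *m G).
Proof. by move=> [M FM] [N GN]; exists (M *m N); apply: mvalM. Qed.

Lemma reg1 n : regular a (1%:M : 'M[ratfun R]_n).
Proof. by eexists; apply: mval1. Qed.

Lemma reg_rf_mx m n (M : 'M[R]_(m, n)) : regular a (rf_mx M).
Proof. by eexists; apply: mval_rf_mx. Qed.

Lemma reg_block m1 m2 n1 n2 (Ful : 'M[ratfun R]_(m1, n1)) (Fur : 'M[ratfun R]_(m1, n2))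
    (Fdl : 'M[ratfun R]_(m2, n1)) (Fdr : 'M[ratfun R]_(m2, n2)) :
  regular a Ful -> regular a Fur -> regular a Fdl -> regular a Fdr ->
  regular a (block_mx Ful Fur Fdl Fdr).
Proof.
move=> /regP rul /regP rur /regP rdl /regP rdr; apply/regP => i j.
by rewrite !mxE; case: splitP => k _; rewrite !mxE; case: splitP.
Qed.

End MatrixValues.

(** If c - e were nonzero, [valV] would make f - f nonzero. *)
Lemma has_value_unique a f c e : has_value a f c -> has_value a f e -> c = e.
Proof.
move=> fc fe; apply/eqP; rewrite -subr_eq0; apply: contraT => ce.
by have := valV (valB fc fe) ce; rewrite subrr eqxx => -[].
Qed.

End Places.

(** * Maximum modulus outside the unit disc *)

Section MaximumModulus.
Variable R : realType.
Local Notation C := R[i].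
Implicit Types (z c r : C) (p q d : {poly C}).

Lemma complex_ge0E z : 0 <= z -> z = (complex.Re z)%:C%C.
Proof. by case: z => x y; rewrite lecE /= => /andP [/eqP -> _]. Qed.

Lemma Re_ge0 z : 0 <= z -> 0 <= complex.Re z.
Proof. by case: z => x y; rewrite lecE /= => /andP []. Qed.

Lemma primitive_root_exists n : (0 < n)%N -> exists w : C, n.-primitive_root w.
Proof.
move=> n0; have [rs rsE] := closed_field_poly_normal ('X^n - 1 : {poly C}).
rewrite (monicP _) ?monicXnsubC // scale1r in rsE.
have rn1 : all n.-unity_root rs by apply/allP => z; rewrite -root_prod_XsubC -rsE.
have srs : (n < (size rs).+1)%N.
  by rewrite -(size_prod_XsubC rs id) -rsE size_XnsubC.
have [|w] := hasP (has_prim_root n0 rn1 _ srs); last by exists w.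
by rewrite -separable_prod_XsubC -rsE separable_Xn_sub_1 // pnatr_eq0 -lt0n.
Qed.

Lemma sum_primitive_root (n k : nat) (w : C) : n.-primitive_root w ->
  \sum_(j < n) w ^+ (j * k) = if (n %| k)%N then n%:R else 0.
Proof.
move=> pw; have [/dvdnP [l ->]|nk] := boolP (n %| k)%N.
  rewrite (eq_bigr (fun=> 1)) ?sumr_const ?card_ord // => j _.
  by apply/eqP; rewrite -(prim_order_dvd pw) mulnA dvdn_mull.
have wk : w ^+ k - 1 != 0 by rewrite subr_eq0 -(prim_order_dvd pw).
(* The factor w^k - 1 turns the geometric sum into w^(k n) - 1 = 0. *)
apply: (mulfI wk); rewrite mulr0.
rewrite (eq_bigr (fun j : 'I_n => (w ^+ k) ^+ j)); last first.
  by move=> j _; rewrite mulnC exprM.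
rewrite -subrX1 -exprM; apply/eqP.
by rewrite subr_eq0 -(prim_order_dvd pw) dvdn_mull.
Qed.

Lemma norm_primitive_root (n : nat) (w : C) : n.-primitive_root w -> `|w| = 1.
Proof.
move=> pw; have n0 := prim_order_gt0 pw.
by apply/eqP; rewrite -(@pexpr_eq1 _ _ n) // -normrX prim_expr_order // normr1.
Qed.

(* Averaging over the roots of unity of large order extracts the coefficient. *)
Lemma coef_circle_bound p r (k : nat) :
  (forall z, `|z| = 1 -> `|p.[z]| <= r) -> `|p`_k| <= r.
Proof.
(* Since n exceeds both k and the degree of p, no other index of p is congruent to k modulo n; the
   weight w^(j (n - k)) used below is w^(- j k). *)
move=> pr; set n := (size p + k).+1.
have [w pw] := @primitive_root_exists n isT.
have nw := norm_primitive_root pw.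
have kn : (k < n)%N by rewrite ltnS leq_addl.
have pE z : p.[z] = \sum_(i < n) p`_i * z ^+ i.
  by rewrite (@horner_coef_wide _ n) // leqW // leq_addr.
have sumE : \sum_(j < n) w ^+ (j * (n - k)) * p.[w ^+ j] = n%:R * p`_k.
  under eq_bigr => j _ do rewrite pE mulr_sumr.
  rewrite exchange_big /= (bigD1 (Ordinal kn)) //= [X in _ + X]big1 ?addr0.
    rewrite (eq_bigr (fun j : 'I_n => p`_k)).
      by rewrite sumr_const card_ord mulr_natl.
    move=> j _; rewrite mulrCA -exprM -exprD -mulnDr subnK ?(ltnW kn) //.
    rewrite (_ : w ^+ _ = 1) ?mulr1 //.
    by apply/eqP; rewrite -(prim_order_dvd pw) dvdn_mull.
  move=> i ik.
  under eq_bigr => j _ do rewrite mulrCA -exprM -exprD -mulnDr.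
  rewrite -mulr_sumr sum_primitive_root // ifN ?mulr0 //.
  rewrite -[(n - k + i)%N]/(n - k + i)%N.
  apply: contra ik => dv; apply/eqP/val_inj => /=; have := ltn_ord i => ilt.
  have : (n %| n - k + i + k)%N = (n %| k)%N by rewrite dvdn_addr.
  rewrite addnAC subnK ?(ltnW kn) // dvdn_addr // => ik2.
  case: (ltngtP i k) => // lt; exfalso.
    have : (n %| (n - k + i))%N := dv; move/dvdn_leq; lia.
  have := dv; rewrite (_ : n - k + i = n + (i - k))%N; last by lia.
  by rewrite dvdn_addr // => /dvdn_leq; lia.
have n0 : 0 < n%:R :> C by rewrite ltr0n.
rewrite -(ler_pM2l n0) -[X in X * `|_|](ger0_norm (ltW n0)) -normrM -sumE.
apply: le_trans (ler_norm_sum _ _ _) _.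
rewrite mulr_natl -[X in _ *+ X]card_ord -sumr_const; apply: ler_sum => j _.
by rewrite normrM !normrX nw !expr1n mul1r pr // normrX nw expr1n.
Qed.

(* Applied to the powers of a polynomial, this removes the number of terms from the
   bound of a polynomial by its coefficients. *)
Lemma lin_exp_bound (x y : R) (m : nat) : 0 <= x -> 0 <= y ->
  (forall k : nat, x ^+ k <= (m * k).+1%:R * y ^+ k) -> x <= y.
Proof.
move=> x0 y0 xy; rewrite leNgt; apply/negP => yx.
have [y00|ypos] := eqVneq y 0.
  by have := xy 1%N; rewrite y00 expr1 expr0n /= mulr0 leNgt -y00 yx.
have yp : 0 < y by rewrite lt0r ypos.
pose t := x / y; have t1 : 1 < t by rewrite ltr_pdivlMr ?mul1r.
set e := t - 1; have e0 : 0 < e by rewrite subr_gt0.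
have tk k : t ^+ k <= (m * k).+1%:R.
  by rewrite expr_div_n ler_pdivrMr ?exprn_gt0.
have bern k : 1 + k%:R * e <= t ^+ k.
  elim: k => [|k IH]; first by rewrite mul0r addr0 expr0.
  rewrite exprS; apply: le_trans (_ : t * (1 + k%:R * e) <= _); last first.
    by rewrite ler_wpM2l // (le_trans ler01) // ltW.
  have -> : t = 1 + e by rewrite /e addrC subrK.
  rewrite -subr_ge0.
  have -> : (1 + e) * (1 + k%:R * e) - (1 + k.+1%:R * e) = k%:R * e ^+ 2.
    by rewrite -natr1; ring.
  by rewrite mulr_ge0 // ?ler0n // sqr_ge0.
(* Bernoulli at N, squared, gives N^2 e^2 <= t^(2 N) <= 2 m N + 1 <= (2 m + 1) N, which this N
   contradicts. *)
have [N] : exists N : nat, (2 * m).+1%:R < N%:R * e ^+ 2.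
  exists (Num.bound ((2 * m).+1%:R / e ^+ 2)).
  rewrite -ltr_pdivrMr ?exprn_gt0 //.
  by apply: archi_boundP; rewrite divr_ge0 ?ler0n ?exprn_ge0 // ltW.
have [->|N0] := posnP N; first by rewrite mul0r ltrn0.
apply/negP; rewrite -leNgt.
have N0R : 0 < N%:R :> R by rewrite ltr0n.
rewrite -(ler_pM2l N0R).
apply: le_trans (_ : (t ^+ N) ^+ 2 <= _); last first.
  by rewrite -exprM; apply: le_trans (tk _) _; rewrite -natrM ler_nat; nia.
apply: le_trans (_ : (1 + N%:R * e) ^+ 2 <= _); last first.
  have b0 : 0 <= 1 + N%:R * e by rewrite addr_ge0 // mulr_ge0 // ltW.
  by rewrite lerXn2r ?nnegrE ?(le_trans b0 (bern N)).
have : 0 <= N%:R * e by rewrite mulr_ge0 // ltW.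
by move=> ?; nra.
Qed.

Lemma lin_exp_boundC (x y : C) (m : nat) : 0 <= x -> 0 <= y ->
  (forall k : nat, x ^+ k <= (m * k).+1%:R * y ^+ k) -> x <= y.
Proof.
move=> x0 y0; rewrite (complex_ge0E x0) (complex_ge0E y0) lecR => xy.
apply: (@lin_exp_bound _ _ m); rewrite ?Re_ge0 // => k.
by have := xy k; rewrite -!rmorphXn -(rmorph_nat (real_complex R)) -rmorphM lecR.
Qed.

Definition mag (a : option C) : C := if a is Some z then `|z| else 1.

(** Growth bound of Bernstein-Walsh type. The coefficients of p^k are at most r^k in modulus, so
    |p(z)|^k <= (m k + 1) (r |z|^m)^k, and [lin_exp_boundC] removes the factor m k + 1. At infinity
    the value is itself a coefficient. *)
Lemma heval_circle_bound a m p r : exterior a -> (size p <= m.+1)%N -> 0 <= r ->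
  (forall z, `|z| = 1 -> `|p.[z]| <= r) -> `|heval a m p| <= r * mag a ^+ m.
Proof.
case: a => [z|] /= z1 sp r0 pr; last first.
  by rewrite expr1n mulr1; apply: coef_circle_bound.
have z0 : 0 <= `|z| by [].
apply: (@lin_exp_boundC _ _ m) => // [|k]; first by rewrite mulr_ge0 // exprn_ge0.
have spk : (size (p ^+ k) <= (m * k).+1)%N.
  apply: leq_trans (size_exp_leq _ _) _; rewrite ltnS leq_mul2r; apply/orP; right.
  by case: (size p) sp.
rewrite -normrX -horner_exp (@horner_coef_wide _ (m * k).+1) //.
apply: le_trans (ler_norm_sum _ _ _) _.
apply: le_trans (_ : \sum_(i < (m * k).+1) (r * `|z| ^+ m) ^+ k <= _); last first.
  by rewrite sumr_const card_ord mulr_natl.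
apply: ler_sum => i _; rewrite normrM normrX exprMn -exprM ler_pM ?exprn_ge0 //.
  apply: coef_circle_bound => w w1.
  by rewrite horner_exp normrX lerXn2r ?nnegrE // pr.
by rewrite ler_weXn2l // -ltnS.
Qed.

Lemma expr_small (x e : C) :
  0 <= x -> x < 1 -> 0 < e -> exists M : nat, x ^+ M.+1 <= e.
Proof.
move=> x0 x1 e0; have xE := complex_ge0E x0; have eE := complex_ge0E (ltW e0).
have nx : `|complex.Re x| < 1 by rewrite ger0_norm ?Re_ge0 // -ltcR -xE.
have e0' : 0 < complex.Re e by rewrite -ltcR -eE.
have /cvgrPdist_le/(_ _ e0') [N _ xN] := cvg_expr nx.
exists N; have /= := xN N.+1 (leqnSn _).
rewrite sub0r normrN xE eE -rmorphXn lecR; apply: le_trans; exact: ler_norm.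
Qed.

Lemma prod_norm_bounds (rs : seq C) (M : nat) (rho z : C) :
  0 <= rho -> rho <= 1 ->
  (forall b, b \in rs -> `|b| <= rho) -> 1 <= `|z| ->
  (1 - rho ^+ M) ^+ size rs * `|z| ^+ (size rs * M)
    <= `|\prod_(b <- rs) (z ^+ M - b ^+ M)|
    <= (1 + rho ^+ M) ^+ size rs * `|z| ^+ (size rs * M).
Proof.
move=> rho0 rho1 + z1; elim: rs => [|b rs IH] brs.
  by rewrite big_nil /= !expr0 mulr1 normr1 lexx.
have /andP [IHl IHr] : _ := IH (fun c cr => brs c (mem_behead (s := b :: rs) cr)).
have bM : `|b ^+ M| <= rho ^+ M * `|z| ^+ M.
  rewrite normrX; apply: le_trans (_ : rho ^+ M <= _).
    by rewrite lerXn2r ?nnegrE ?brs ?mem_head.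
  by rewrite ler_peMr ?exprn_ge0 // exprn_ege1.
rewrite big_cons normrM /= mulSn exprD !exprSr.
have lo : (1 - rho ^+ M) * `|z| ^+ M <= `|z ^+ M - b ^+ M|.
  rewrite mulrBl mul1r; apply: le_trans (_ : `|z ^+ M| - `|b ^+ M| <= _).
    by rewrite normrX lerB.
  exact: lerB_dist.
have hi : `|z ^+ M - b ^+ M| <= (1 + rho ^+ M) * `|z| ^+ M.
  by rewrite mulrDl mul1r; apply: le_trans (ler_normB _ _) _; rewrite normrX lerD.
have r1 : 0 <= 1 - rho ^+ M by rewrite subr_ge0 exprn_ile1.
apply/andP; split.
  rewrite [X in X <= _](_ : _ = (1 - rho ^+ M) * `|z| ^+ M *
     ((1 - rho ^+ M) ^+ size rs * `|z| ^+ (size rs * M))); last by ring.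
  by rewrite ler_pM // mulr_ge0 // exprn_ge0.
rewrite [X in _ <= X](_ : _ = (1 + rho ^+ M) * `|z| ^+ M *
     ((1 + rho ^+ M) ^+ size rs * `|z| ^+ (size rs * M))); last by ring.
by rewrite ler_pM.
Qed.

Lemma expr_limit (x y rho : C) (n : nat) :
  0 <= x -> 0 <= y -> 0 <= rho -> rho < 1 ->
  (forall M : nat, x * (1 - rho ^+ M.+1) ^+ n <= y * (1 + rho ^+ M.+1) ^+ n) -> x <= y.
Proof.
move=> x0 y0 rho0 rho1 xy.
(* From (1 - d)^n >= 1 - n d and (1 + d)^n <= 1 + 3^n d the hypothesis yields x <= y + d (x n + y
   3^n); the summand 1 makes the divisor positive. *)
have K0 : 0 < x * n%:R + y * (3 ^ n)%:R + 1.
  by rewrite ltr_wpDl // addr_ge0 // mulr_ge0.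
apply/ler_addgt0Pr => e e0.
have [M rM] := expr_small rho0 rho1 (divr_gt0 e0 K0).
set d := rho ^+ M.+1 in rM; have d0 : 0 <= d by rewrite exprn_ge0.
have d1 : d <= 1 by rewrite exprn_ile1 // ltW.
have lo : 1 - n%:R * d <= (1 - d) ^+ n.
  elim: n {xy K0 rM} => [|k IH]; first by rewrite mul0r subr0.
  rewrite exprS; apply: le_trans (_ : (1 - d) * (1 - k%:R * d) <= _); last first.
    by rewrite ler_wpM2l // subr_ge0.
  rewrite -subr_ge0.
  have -> : (1 - d) * (1 - k%:R * d) - (1 - k.+1%:R * d) = k%:R * d ^+ 2.
    by rewrite -natr1; ring.
  by rewrite mulr_ge0 // exprn_ge0.
have hi : (1 + d) ^+ n <= 1 + (3 ^ n)%:R * d.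
  elim: n {xy K0 rM lo} => [|k IH]; first by rewrite expr0 lerDl mulr_ge0.
  rewrite exprS; apply: le_trans (_ : (1 + d) * (1 + (3 ^ k)%:R * d) <= _).
    by rewrite ler_wpM2l // addr_ge0.
  rewrite -subr_ge0 expnS natrM.
  have -> : 1 + 3 * (3 ^ k)%:R * d - (1 + d) * (1 + (3 ^ k)%:R * d)
     = d * ((3 ^ k)%:R * (1 - d) + ((3 ^ k)%:R - 1)).
    by ring.
  rewrite mulr_ge0 // addr_ge0 ?mulr_ge0 ?subr_ge0 //.
  by rewrite ler1n expn_gt0.
have step : x * (1 - n%:R * d) <= y * (1 + (3 ^ n)%:R * d).
  apply: le_trans (_ : x * (1 - d) ^+ n <= _); first by rewrite ler_wpM2l.
  by apply: le_trans (xy M) _; rewrite ler_wpM2l.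
have dK : d * (x * n%:R + y * (3 ^ n)%:R + 1) <= e by rewrite -ler_pdivlMr.
apply: le_trans (_ : y + d * (x * n%:R + y * (3 ^ n)%:R + 1) <= _);
  last by rewrite lerD2l.
rewrite -subr_ge0 in step; rewrite -subr_ge0.
apply: le_trans step _; rewrite -subr_ge0.
by rewrite [X in 0 <= X](_ : _ = d) //; ring.
Qed.

(* Multiplying [d] by [g] turns its factors X - b into X^M - b^M, whose modulus on
   the exterior is |z|^M up to a factor tending to 1; so |p / d| is, in the limit,
   the modulus of the polynomial p g. *)
Lemma circle_maximum d p r a m : d != 0 -> (size d).-1 = m ->
  (forall z, root d z -> `|z| < 1) -> (size p <= m.+1)%N -> 0 <= r ->
  (forall z, `|z| = 1 -> `|p.[z]| <= r * `|d.[z]|) ->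
  exterior a -> `|heval a m p| <= r * `|heval a m d|.
Proof.
move=> d0 sd droot sp r0 pd ea.
have [rs dE] := closed_field_poly_normal d; set c := lead_coef d in dE.
have c0 : c != 0 by rewrite lead_coef_eq0.
have srs : size rs = m.
  by rewrite -sd dE size_scale // size_prod_XsubC.
have rs1 b : b \in rs -> `|b| < 1.
  by move=> brs; apply: droot; rewrite dE rootZ // root_prod_XsubC.
(* Finitely many roots: the largest modulus, or 0 without roots, is a uniform bound below 1. *)
have [rho [rho0 rho1 rsrho]] : exists rho : C, [/\ 0 <= rho, rho < 1 &
    forall b, b \in rs -> `|b| <= rho].
  elim: rs {dE srs} rs1 => [_|b rs IH brs]; first by exists 0.
  have [|rho [rho0 rho1 rsrho]] := IH.
    by move=> x xrs; apply: brs; rewrite in_cons xrs orbT.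
  have b1 : `|b| < 1 by rewrite brs ?mem_head.
  have [rb|br] : `|b| <= rho \/ rho <= `|b|.
    by apply/orP/real_leVge; rewrite ?normr_real ?ger0_real.
  - exists rho; split=> // x; rewrite in_cons => /orP [/eqP -> //|]; exact: rsrho.
  - exists `|b|; split=> // x; rewrite in_cons => /orP [/eqP -> //|/rsrho xr].
    exact: le_trans br.
apply: (@expr_limit _ _ rho m) => //; first by rewrite mulr_ge0.
move=> M; set eps := rho ^+ M.+1.
pose g := \prod_(b <- rs) \sum_(i < M.+1) 'X^(M - i) * b%:P ^+ i.
pose Q := \prod_(b <- rs) ('X^(M.+1) - (b ^+ M.+1)%:P).
have dgE : d * g = c *: Q.
  rewrite dE -scalerAl -big_split /=; congr (_ *: _); apply: eq_bigr => b _.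
  by rewrite rmorphXn [RHS]subrXX.
have sg : (size g <= (m * M).+1)%N.
  rewrite -srs /g; elim: (rs) => [|b l IH]; first by rewrite big_nil size_poly1.
  rewrite big_cons mulSn; apply: size_mul_leqS => //.
  apply: leq_trans (size_sum _ _ _) _; apply/bigmax_leqP => i _.
  rewrite -rmorphXn mulrC mul_polyC.
  by rewrite (leq_trans (size_scale_leq _ _)) // size_polyXn ltnS leq_subr.
have evQ : (1 - eps) ^+ m * mag a ^+ (m * M.+1) <= `|heval a (m * M.+1) Q|.
  case: (a) ea => [z|] /= z1.
    rewrite horner_prod -srs.
    have /andP [lo _] := prod_norm_bounds M.+1 rho0 (ltW rho1) rsrho z1.
    by under eq_bigr => b _ do rewrite !hornerE; exact: lo.
  have -> : Q`_(m * M.+1) = 1.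
    rewrite /Q -srs; elim: (rs) => [|b l IH]; first by rewrite big_nil coef1.
    rewrite big_cons mulSn coefM_top ?IH ?mulr1.
    - by rewrite coefB coefXn eqxx coefC subr0.
    - by rewrite size_XnsubC.
    - elim: (l) => [|b' l' IHl]; first by rewrite big_nil size_poly1.
      by rewrite big_cons mulSn size_mul_leqS // size_XnsubC.
  rewrite expr1n mulr1 normr1 exprn_ile1 ?subr_ge0 ?gerBl ?exprn_ge0 //.
  by rewrite exprn_ile1 // ltW.
have eps0 : 0 <= eps by rewrite exprn_ge0.
have circ z : `|z| = 1 -> `|(p * g).[z]| <= r * (`|c| * (1 + eps) ^+ m).
  move=> z1; have dz : 0 < `|d.[z]|.
    by rewrite normr_gt0; apply/negP => /droot; rewrite z1 ltxx.
  have Qz : `|Q.[z]| <= (1 + eps) ^+ m.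
    rewrite horner_prod -srs.
    have z1' : 1 <= `|z| by rewrite z1.
    have /andP [_ hi] := prod_norm_bounds M.+1 rho0 (ltW rho1) rsrho z1'.
    rewrite z1 expr1n mulr1 in hi.
    by under eq_bigr => b _ do rewrite !hornerE; exact: hi.
  rewrite -(ler_pM2l dz) hornerM.
  have -> : `|d.[z]| * `|p.[z] * g.[z]| = `|p.[z]| * (`|c| * `|Q.[z]|).
    by rewrite normrM mulrCA -[X in _ * X]normrM -hornerM dgE hornerZ normrM.
  apply: le_trans (_ : `|p.[z]| * (`|c| * (1 + eps) ^+ m) <= _).
    by rewrite !ler_wpM2l.
  rewrite [leRHS]mulrA [X in _ <= X * _]mulrC ler_wpM2r ?pd //.
  by rewrite mulr_ge0 // exprn_ge0 // addr_ge0.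
have B0 : 0 <= r * (`|c| * (1 + eps) ^+ m).
  by rewrite !mulr_ge0 // exprn_ge0 // addr_ge0.
have := heval_circle_bound ea (size_mul_leqS sp sg) B0 circ.
have sd' : (size d <= m.+1)%N by rewrite -sd; case: (size d).
(* The products p g and d g share the degree bound m + m M = m (M + 1), so their values at infinity
   correspond too. *)
have mM : (m + m * M)%N = (m * M.+1)%N by rewrite mulnS.
have dgev : heval a m d * heval a (m * M) g = c * heval a (m * M.+1) Q.
  rewrite -hevalM // mM dgE.
  by case: (a) => [z|] /=; rewrite ?hornerZ ?coefZ.
rewrite hevalM // mM normrM => bd.
(* The bound on p g, multiplied by |d(a)|, becomes one on p because d g = c Q; the lower bound [evQ]
   then cancels c and the power of [mag a]. *)
have main : `|heval a m p| * (`|c| * `|heval a (m * M.+1) Q|) <=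
   r * `|heval a m d| * (`|c| * ((1 + eps) ^+ m * mag a ^+ (m * M.+1))).
  rewrite -normrM -dgev normrM mulrCA.
  have := ler_wpM2l (normr_ge0 (heval a m d)) bd.
  by congr (_ <= _); ring.
have magp : 0 < mag a ^+ (m * M.+1).
  rewrite exprn_gt0 //; case: (a) ea => [z|] //=; exact: lt_le_trans.
have cp : 0 < `|c| by rewrite normr_gt0.
rewrite -(ler_pM2r (mulr_gt0 cp magp)).
apply: le_trans (_ : `|heval a m p| * (`|c| * `|heval a (m * M.+1) Q|) <= _).
  rewrite -mulrA ler_wpM2l // mulrCA ler_wpM2l //.
by apply: le_trans main _; rewrite -[leRHS]mulrA [X in _ <= _ * X]mulrCA lexx.
Qed.

End MaximumModulus.

(** * Gain of a matrix and the small gain theorem *)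

Section SmallGain.
Variable R : realType.
Local Notation C := R[i].
Local Notation toC := (map_poly (real_complex R)).
Local Open Scope sesquilinear_scope.

Lemma conjtr_mul m n p (A : 'M[C]_(m, n)) (B : 'M[C]_(n, p)) :
  (A *m B) ^t* = B ^t* *m A ^t*.
Proof. by rewrite trmx_mul map_mxM. Qed.

Definition sqn n (v : 'cV[C]_n) : C := \sum_i `|v i 0| ^+ 2.

Lemma sqn_ge0 n (v : 'cV[C]_n) : 0 <= sqn v.
Proof. by apply: sumr_ge0 => i _; rewrite exprn_ge0. Qed.

Lemma sqnE n (v : 'cV[C]_n) : sqn v = (v ^t* *m v) 0 0.
Proof. by rewrite mxE; apply: eq_bigr => i _; rewrite !mxE normCK mulrC. Qed.

Lemma sqn_conjtr n (u : 'rV[C]_n) : (u *m u ^t*) 0 0 = sqn (u ^t*).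
Proof. by rewrite sqnE trmxCK. Qed.

(** A bound on the spectral norm, squared so that no square root is taken in C. *)
Definition gain_le (r : C) m n (M : 'M[C]_(m, n)) : Prop :=
  forall v, sqn (M *m v) <= r ^+ 2 * sqn v.

Lemma gain_leM (r s : C) m n p (M : 'M[C]_(m, n)) (N : 'M[C]_(n, p)) :
  0 <= r -> gain_le r M -> gain_le s N -> gain_le (r * s) (M *m N).
Proof.
move=> r0 rM sN v; rewrite -mulmxA; apply: le_trans (rM _) _.
rewrite exprMn -[leRHS]mulrA; apply: ler_wpM2l; [exact: exprn_ge0 | exact: sN].
Qed.

Lemma gain_le_mono (r s : C) m n (M : 'M[C]_(m, n)) :
  0 <= r -> r <= s -> gain_le r M -> gain_le s M.
Proof.
move=> r0 rs rM v; apply: le_trans (rM v) _.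
by rewrite ler_wpM2r ?sqn_ge0 // lerXn2r ?nnegrE // (le_trans r0).
Qed.

(** * Spectral decomposition of the Gram matrix *)

Section Gram.
Variables (m n : nat) (M : 'M[C]_(m, n)).
Let H := M ^t* *m M.
Let P := spectralmx H.
Let D := spectral_diag H.

Lemma gram_spectral : H = P ^t* *m diag_mx D *m P.
Proof.
rewrite -invmx_unitary ?spectral_unitarymx //; apply/orthomx_spectralP.
by apply/normalmxP; rewrite /H conjtr_mul trmxCK.
Qed.

Let PP : P *m P ^t* = 1%:M.
Proof. by apply/unitarymxP/spectral_unitarymx. Qed.

Let PP' : P ^t* *m P = 1%:M.
Proof. by apply: mulmx1C. Qed.

Lemma sqn_gram (v : 'cV[C]_n) :
  sqn (M *m v) = \sum_i D 0 i * `|(P *m v) i 0| ^+ 2.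
Proof.
rewrite sqnE conjtr_mul -mulmxA (mulmxA _ M) -/H gram_spectral.
rewrite -!mulmxA (mulmxA (v ^t*)) -conjtr_mul mxE; apply: eq_bigr => i _.
by rewrite mul_diag_mx !mxE normCKC mulrCA.
Qed.

Lemma sqn_spectral (v : 'cV[C]_n) : sqn (P *m v) = sqn v.
Proof. by rewrite !sqnE conjtr_mul -mulmxA (mulmxA _ P) PP' mul1mx. Qed.

Lemma spectral_rowE i : row i P *m H = D 0 i *: row i P.
Proof.
rewrite gram_spectral -row_mul !mulmxA PP mul1mx mul_diag_mx.
by apply/rowP => j; rewrite !mxE.
Qed.

Lemma gram_eigenvalue i : eigenvalue H (D 0 i).
Proof.
apply/eigenvalueP; exists (row i P); first exact: spectral_rowE.
apply/eqP => /(congr1 (fun v => (v *m P ^t*) 0 i)).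
by rewrite -row_mul PP mul0mx !mxE eqxx => /eqP; rewrite oner_eq0.
Qed.

Lemma gram_diag_ge0 i : 0 <= D 0 i.
Proof.
(* P sends the conjugate transpose of its i-th row to the i-th basis vector, so [D 0 i] is itself a
   squared norm. *)
have := sqn_gram ((row i P) ^t*); rewrite (bigD1 i) //= big1 ?addr0.
  suff -> : (P *m (row i P) ^t*) i 0 = 1.
    by rewrite normr1 expr1n mulr1 => <-; apply: sqn_ge0.
  rewrite tr_row map_col -[P in P *m _]/P colE mulmxA PP mul1mx mxE eqxx.
  by [].
move=> j ji; rewrite tr_row map_col colE mulmxA PP mul1mx mxE (negPf ji).
by rewrite normr0 expr0n mulr0.
Qed.

Lemma gram_eigenvalueP a : eigenvalue H a -> exists i, a = D 0 i.
Proof.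
case/eigenvalueP => u uH u0; pose w := u *m P ^t*.
have wD : w *m diag_mx D = a *: w.
  rewrite /w -[LHS]mulmx1 -PP !mulmxA -(mulmxA u) -(mulmxA u) -gram_spectral uH.
  by rewrite scalemxAl.
have [i wi] : exists i, w 0 i != 0.
  apply/existsP; apply: contraNT u0; rewrite negb_exists => /forallP w0.
  have wz : w = 0.
    by apply/rowP => i; rewrite [RHS]mxE; apply/eqP; have := w0 i; rewrite negbK.
  by rewrite -[u]mulmx1 -PP' mulmxA -/w wz mul0mx.
exists i; have /rowP/(_ i) := wD; rewrite mul_mx_diag mxE [RHS]mxE mulrC => e.
by apply: (mulIf wi).
Qed.

Lemma has_ubound_singular_values : has_ubound (singular_values M).
Proof.
(* Here s <= 1 + s^2, and s^2 is one of the diagonal entries. *)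
exists (1 + \sum_i `|complex.Re (D 0 i)|) => s [s0 /gram_eigenvalueP [i sD]].
have := congr1 (@complex.Re R) sD; rewrite /= => s2.
have le1 : `|complex.Re (D 0 i)| <= \sum_i `|complex.Re (D 0 i)|.
  by rewrite (bigD1 i) //= lerDl sumr_ge0.
apply: le_trans (_ : 1 + s ^+ 2 <= _).
  by have := sqr_ge0 (s - 1); rewrite sqrrB1 -subr_ge0 => ?; nra.
by rewrite lerD2l s2; apply: le_trans le1; apply: ler_norm.
Qed.

Lemma sigma_max_ge0 : 0 <= sigma_max M.
Proof.
have [[s sM]|s0] := pselect (exists s, singular_values M s).
  by apply: le_trans (ub_le_sup has_ubound_singular_values sM); case: sM.
(* Without singular values the supremum is that of the empty set, whose default value is 0. *)
rewrite /sigma_max (_ : singular_values M = set0) ?sup0 //.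
by apply/seteqP; split => // s sM; case: s0; exists s.
Qed.

Lemma gain_le_sigma_max : gain_le (sigma_max M)%:C%C M.
Proof.
move=> v; rewrite sqn_gram -sqn_spectral /sqn mulr_sumr; apply: ler_sum => i _.
rewrite ler_wpM2r ?exprn_ge0 //; have Di := gram_diag_ge0 i.
have DE := complex_ge0E Di; have R0 := Re_ge0 Di.
have /(ub_le_sup has_ubound_singular_values) sM :
    singular_values M (Num.sqrt (complex.Re (D 0 i))).
  by split; rewrite ?sqrtr_ge0 // sqr_sqrtr // -DE; apply: gram_eigenvalue.
rewrite DE -rmorphXn lecR -[leLHS](sqr_sqrtr R0).
by rewrite lerXn2r ?nnegrE ?sqrtr_ge0 ?sigma_max_ge0.
Qed.

End Gram.

Lemma unit_circle_cis (z : C) :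
  `|z| = 1 -> exists w : R, z = (cos w +i* sin w)%C.
Proof.
case: z => x y z1; have xy : x ^+ 2 + y ^+ 2 = 1.
  have := sqr_normc (x +i* y)%C; rewrite z1 expr1n /=.
  by case; rewrite mulrN opprK -!expr2 => ->.
have x1 : -1 <= x <= 1.
  by rewrite -ler_norml -(@expr_le1 _ 2) // real_normK ?num_real // -xy lerDl sqr_ge0.
have yE : Num.sqrt (1 - x ^+ 2) = `|y| by rewrite -xy addrAC subrr add0r sqrtr_sqr.
have [y0|y0] := leP 0 y.
  by exists (acos x); rewrite acosK // sin_acos // yE ger0_norm.
by exists (- acos x); rewrite cosN sinN acosK // sin_acos // yE ltr0_norm // opprK.
Qed.

(** The norm is computed on reduced fractions; uniqueness of values transfers its bound to any value
    matrix. *)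
Lemma hinf_gain m n (F : 'M[ratfun R]_(m, n)) (h : R) (z : C) M :
  (hinf_norm F <= h%:E)%E -> `|z| = 1 -> mx_has_value (Some z) F M -> gain_le h%:C%C M.
Proof.
move=> Fh /unit_circle_cis [w zE] FM; subst z.
set z := (cos w +i* sin w)%C in FM.
have ME : M = map_mx (fun f => rf_eval f z) F.
  apply/matrixP => i j; rewrite mxE; apply: has_value_unique (FM i j) _.
  by apply: nopole_val; apply: val_nopole (FM i j).
have sh : sigma_max M <= h.
  rewrite -lee_fin; apply: le_trans Fh; apply: ereal_sup_ubound.
  by exists w; [exact: I | rewrite -ME].
apply: (@gain_le_mono (sigma_max M)%:C%C); last exact: gain_le_sigma_max.
  by rewrite lecR sigma_max_ge0.
by rewrite lecR.
Qed.

Lemma hinf_norm_ge0 m n (F : 'M[ratfun R]_(m, n)) : (0 <= hinf_norm F)%E.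
Proof.
apply: le_trans (ereal_sup_ubound _); last by exists 0.
by rewrite lee_fin sigma_max_ge0.
Qed.

(* AM-GM with weight [r] stands in for Cauchy-Schwarz. *)
Lemma gain_quadratic n (M : 'M[C]_n) (u : 'rV[C]_n) (r : C) :
  0 < r -> gain_le r M ->
  `|(u *m M *m u ^t*) 0 0| <= r * sqn (u ^t*).
Proof.
move=> r0 rM; rewrite -mulmxA mxE; apply: le_trans (ler_norm_sum _ _ _) _.
set w := M *m _.
apply: le_trans (_ : \sum_i (r * `|u 0 i| ^+ 2 + `|w i 0| ^+ 2 / r) / 2 <= _).
  apply: ler_sum => i _; rewrite normrM; set x := `|u 0 i|; set y := `|w i 0|.
  have x0 : 0 <= x := normr_ge0 _.
  have y0 : 0 <= y := normr_ge0 _.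
  rewrite -subr_ge0.
  have -> : (r * x ^+ 2 + y ^+ 2 / r) / 2 - x * y = (r * x - y) ^+ 2 / (2 * r).
    by field; rewrite gt_eqF.
  have rx : r * x - y \is Num.real.
    by rewrite realB // ?realM // ?(gtr0_real r0) ?(ger0_real x0) ?(ger0_real y0).
  apply: divr_ge0; first by rewrite -realEsqr.
  by rewrite mulr_ge0 // ltW.
rewrite -mulr_suml big_split /= -mulr_sumr -mulr_suml.
have uE : \sum_i `|u 0 i| ^+ 2 = sqn (u ^t*).
  by apply: eq_bigr => i _; rewrite !mxE norm_conjC.
rewrite uE -/(sqn w); have := rM (u ^t*); rewrite -/w => wr.
rewrite ler_pdivrMr // mulr_natr mulr2n lerD2l ler_pdivrMr //.
by apply: le_trans wr _; rewrite expr2 mulrAC.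
Qed.

(** The product of all reduced denominators serves: its roots are poles of entries, and properness
    of the entries bounds the new numerators. *)
Lemma common_denominator m n (F : 'M[ratfun R]_(m, n)) : RHinf F ->
  exists d : {poly R}, exists N : 'M[{poly R}]_(m, n),
  [/\ d != 0, forall z, root (toC d) z -> `|z| < 1,
      forall i j, (size (N i j) <= size d)%N &
      forall i j, F i j = tofrac (N i j) / tofrac d].
Proof.
case=> pF sF; pose d := \prod_(k : 'I_m * 'I_n) denr (F k.1 k.2).
have dd i j : denr (F i j) %| d by rewrite /d (bigD1 (i, j)) //= dvdp_mulr.
have d0 : d != 0 by apply/prodf_neq0 => k _; apply: denr_neq0.
exists d, (\matrix_(i, j) (numr (F i j) * (d %/ denr (F i j)))); split=> //.
- move=> z; rewrite rmorph_prod rootE horner_prod => /prodf_eq0 [[i j] _ rz].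
  exact: (sF i j).
- move=> i j; rewrite mxE.
  have := congr1 (size \o polyseq) (divpK (dd i j)) => /=.
  have q0 : d %/ denr (F i j) != 0 by rewrite dvdp_div_eq0.
  rewrite size_mul ?denr_neq0 // => <-; apply: leq_trans (size_polyMleq _ _) _.
  by rewrite addnC -!subn1 leq_sub2r // leq_add2l; apply: pF.
- move=> i j; rewrite mxE; have fd : tofrac d != 0 by rewrite tofrac_eq0.
  have fd' : tofrac (denr (F i j)) != 0 by rewrite tofrac_eq0 denr_neq0.
  rewrite {1}[F i j]numr_denrE; apply/eqP; rewrite (eqr_div (F:=ratfun R) _ _ fd' fd).
  rewrite -(tofracM (numr (F i j)) d) -(tofracM (numr (F i j) * _)).
  by rewrite -mulrA divpK.
Qed.

Lemma heval_sum (I : Type) (l : seq I) (P : pred I) (q : I -> {poly C}) a m :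
  heval a m (\sum_(i <- l | P i) q i) = \sum_(i <- l | P i) heval a m (q i).
Proof. by case: a => [z|] /=; rewrite ?horner_sum ?coef_sum. Qed.

Lemma hevalCM (c : C) (q : {poly C}) a m :
  heval a m (c%:P * q) = c * heval a m q.
Proof. by case: a => [z|] /=; rewrite ?hornerCM ?coefCM. Qed.

(* If u M = - u, the rational function u F u^* / |u|^2 takes the value - 1 at [a]
   while its modulus is at most r on the circle. *)
Theorem small_gain n (F : 'M[ratfun R]_n) (r : C) : RHinf F -> 0 < r -> r < 1 ->
  (forall z M, `|z| = 1 -> mx_has_value (Some z) F M -> gain_le r M) ->
  forall a M, exterior a -> mx_has_value a F M -> 1%:M + M \in unitmx.
Proof.
move=> RF r0 r1 Fr a M ea FM; have [d [N [d0 droot sN FE]]] := common_denominator RF.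
set m := (size d).-1.
have sd : size d = m.+1 by rewrite prednK // size_poly_gt0.
have valF b : exterior b -> heval b m (toC d) != 0 /\
    mx_has_value b F (\matrix_(i, j) (heval b m (toC (N i j)) / heval b m (toC d))).
  move=> eb; have hd : heval b m (toC d) != 0.
    case: b eb => [z|] /= z1.
      by apply/negP => /droot; rewrite (le_gtF z1).
    by rewrite coef_map fmorph_eq0 -lead_coefE lead_coef_eq0.
  split=> // i j; exists m, (N i j), d; rewrite -sd sN; split=> //.
  by rewrite mxE.
rewrite -row_free_unit -kermx_eq0; apply/rowV0P => u /sub_kermxP.
rewrite mulmxDr mulmx1 => /eqP; rewrite addrC addr_eq0 => /eqP uM.
pose S := sqn (u ^t*); apply/eqP; apply: contraTT isT => u0.
have S0 : 0 < S.
  rewrite lt0r sqn_ge0 andbT; apply: contraNneq u0 => /eqP.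
  rewrite psumr_eq0 => [/allP Sz|i _]; last by rewrite exprn_ge0.
  apply/eqP/rowP => i; have := Sz i (mem_index_enum _).
  by rewrite /= expf_eq0 /= !mxE norm_conjC normr_eq0 => /eqP.
(* The numerator of u F u^* over the common denominator d; u does not depend on z. *)
pose p := \sum_i \sum_j (u 0 i * (u 0 j)^*)%:P * toC (N i j).
have pE b : exterior b -> forall M', mx_has_value b F M' ->
    heval b m p = heval b m (toC d) * (u *m M' *m u ^t*) 0 0.
  move=> eb M' FM'; have [hd Fb] := valF b eb.
  have -> : M' = \matrix_(i, j) (heval b m (toC (N i j)) / heval b m (toC d)).
    by apply/matrixP => i j; apply: has_value_unique (FM' i j) (Fb i j).
  rewrite heval_sum -mulmxA mxE mulr_sumr; apply: eq_bigr => i _.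
  rewrite heval_sum !mxE !mulr_sumr; apply: eq_bigr => j _.
  rewrite hevalCM !mxE; set v := heval b m _; set e := heval b m _ in hd *.
  by field; exact: hd.
have sp : (size p <= m.+1)%N.
  apply: leq_trans (size_sum _ _ _) _; apply/bigmax_leqP => i _.
  apply: leq_trans (size_sum _ _ _) _; apply/bigmax_leqP => j _.
  by rewrite mul_polyC (leq_trans (size_scale_leq _ _)) // size_map_poly -sd.
have dC0 : toC d != 0 by rewrite map_poly_eq0.
have sdC : (size (toC d)).-1 = m by rewrite size_map_poly.
have rS0 : 0 <= r * S by rewrite mulr_ge0 // ltW.
have circ z : `|z| = 1 -> `|p.[z]| <= r * S * `|(toC d).[z]|.
  move=> z1; have ez : exterior (Some z) by rewrite /= z1.
  have [_ Fz] := valF _ ez.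
  have := pE _ ez _ Fz; rewrite /= => ->; rewrite normrM mulrC ler_wpM2r //.
  by apply: gain_quadratic => //; apply: Fr Fz.
have := circle_maximum dC0 sdC droot sp rS0 circ ea.
rewrite (pE _ ea _ FM) uM mulNmx mxE sqn_conjtr normrM normrN.
have [hd _] := valF _ ea.
rewrite mulrC ler_pM2r ?normr_gt0 // ger0_norm ?(ltW S0) // -/S.
by rewrite -subr_ge0 -{2}[S]mul1r -mulrBl pmulr_lge0 // subr_ge0 (lt_geF r1).
Qed.

End SmallGain.

(** * Stability of a realization from its transfer matrix *)

Section StateSpaceRegularity.
Variable R : realType.
Local Notation C := R[i].
Local Notation toC := (map_poly (real_complex R)).
Local Notation cmx := (map_mx (real_complex R)).
Local Notation zeta := (tofrac ('X : {poly R})).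

(** Exhibits the entrywise map as a composite of ring morphisms, the form to which the [map_mx]
    lemmas apply. *)
Lemma rf_mxE m n (M : 'M[R]_(m, n)) :
  rf_mx M = map_mx (@FracField.tofrac _ \o polyC) M.
Proof. by []. Qed.

Lemma rf_mxD m n (M N : 'M[R]_(m, n)) : rf_mx (M + N) = rf_mx M + rf_mx N.
Proof. by rewrite !rf_mxE map_mxD. Qed.

Lemma rf_mxM m n p (M : 'M[R]_(m, n)) (N : 'M[R]_(n, p)) :
  rf_mx (M *m N) = rf_mx M *m rf_mx N.
Proof. by rewrite !rf_mxE map_mxM. Qed.

Lemma rf_mx0 m n : rf_mx (0 : 'M[R]_(m, n)) = 0.
Proof. by rewrite !rf_mxE map_mx0. Qed.

Lemma rf_mx1 n : rf_mx (1%:M : 'M[R]_n) = 1%:M.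
Proof. by rewrite !rf_mxE map_mx1. Qed.

Lemma rf_mx_block m1 m2 n1 n2 (Mul : 'M[R]_(m1, n1)) (Mur : 'M[R]_(m1, n2))
    (Mdl : 'M[R]_(m2, n1)) (Mdr : 'M[R]_(m2, n2)) :
  rf_mx (block_mx Mul Mur Mdl Mdr) =
  block_mx (rf_mx Mul) (rf_mx Mur) (rf_mx Mdl) (rf_mx Mdr).
Proof. by rewrite !rf_mxE map_block_mx. Qed.

(** * Feedback algebra over a field *)

Section Loop.
Variable F : fieldType.

(** Resolvent identity: expand E^-1 (E - X) S = E^-1. *)
Lemma invmx_rperturb n (E X S : 'M[F]_n) :
  E \in unitmx -> (E - X) *m S = 1%:M ->
  invmx E = S - invmx E *m X *m S.
Proof.
move=> uE e; rewrite -[LHS]mulmx1 -e mulmxBl mulmxBr mulKmx //.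
by rewrite !mulmxA.
Qed.

Lemma invmx_lperturb n (E X S : 'M[F]_n) :
  E \in unitmx -> S *m (E - X) = 1%:M ->
  invmx E = S *m (1%:M - X *m invmx E).
Proof.
move=> uE e; rewrite -[LHS]mul1mx -{1}e -mulmxA; congr (_ *m _).
by rewrite mulmxBl mulmxV.
Qed.

Lemma feedback_transfer n m p (E0 E : 'M[F]_n) (B : 'M[F]_(n, m)) (D : 'M[F]_(m, p))
    (H : 'M[F]_(p, n)) (T0 : 'M[F]_(p, m)) :
  E0 \in unitmx -> E \in unitmx -> E = E0 - B *m D *m H ->
  H *m invmx E0 *m B = T0 ->
  H *m invmx E *m B = T0 + T0 *m D *m (H *m invmx E *m B).
Proof.
set X := B *m D *m H => uE0 uE EE <-.
have e : H *m invmx E *m B = H *m (invmx E0 *m (1%:M - (- X) *m invmx E)) *m B.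
  by rewrite -(@invmx_lperturb _ E (- X)) // opprK EE subrK mulVmx.
by rewrite {1}e mulNmx opprK !mulmxDr mulmx1 mulmxDl /X !mulmxA.
Qed.

(* [G] is the plant, [K0] the strictly proper part and [D] the direct term of the
   controller, and [V] the sensitivity (1 - G K)^-1. *)
Lemma feedback_solve p m (G : 'M[F]_(p, m)) (K0 D : 'M[F]_(m, p)) (V : 'M[F]_p)
    (T : 'M[F]_(p + m, m + p)) :
  V *m (1%:M - G *m (K0 + D)) = 1%:M ->
  T = block_mx G 0 0 K0 + block_mx G 0 0 K0 *m block_mx D 1%:M 1%:M 0 *m T ->
  T = block_mx (V *m G) (V - 1%:M - V *m G *m D)
               (K0 *m V *m G) (K0 *m V - K0 *m V *m G *m D).
Proof.
set T0 := block_mx G 0 0 K0; set D0 := block_mx D _ _ _ => VE TE.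
have VGK0 : V *m G *m K0 = V - 1%:M - V *m G *m D.
  by rewrite -[X in V - X]VE mulmxBr mulmx1 subKr mulmxDr mulmxDr !mulmxA addrK.
(* The inverse of 1 - T0 D0 by the Schur complement of its lower right identity block; that
   complement is 1 - G (K0 + D), with inverse V. *)
set W := block_mx V (V *m G) (K0 *m V) (1%:M + K0 *m V *m G).
have WE : W *m (1%:M - T0 *m D0) = 1%:M.
  have -> : 1%:M - T0 *m D0 = block_mx (1%:M - G *m D) (- G) (- K0) 1%:M.
    rewrite /T0 /D0 mulmx_block !mul0mx !mulmx0 !mulmx1 !addr0 !add0r.
    by rewrite (scalar_mx_block p m) opp_block_mx add_block_mx !add0r subr0.
  rewrite /W mulmx_block !mulmxN !mulmx1 addNr (scalar_mx_block p m).
  have V1 : V *m (1%:M - G *m D) - V *m G *m K0 = 1%:M.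
    by rewrite VGK0 addrAC mulmxBr mulmx1 mulmxA subKr.
  congr block_mx => //.
    rewrite mulmxDl mul1mx opprD addrCA -!mulmxA -mulmxBr.
    by rewrite (mulmxA V) V1 mulmx1 addNr.
  by rewrite addrCA addNr addr0.
have -> : T = W *m T0.
  by rewrite -[LHS]mul1mx -WE -mulmxA mulmxBl mul1mx {1}TE addrK.
rewrite /W /T0 mulmx_block !mulmx0 !addr0 !add0r VGK0; congr block_mx.
have e : K0 *m V *m G *m K0 = K0 *m V - K0 - K0 *m V *m G *m D.
  by rewrite -(mulmxA (K0 *m V)) -(mulmxA K0) (mulmxA V) VGK0 !mulmxBr mulmx1 !mulmxA.
by rewrite mulmxDl mul1mx e addrA [K0 + _]addrC subrK.
Qed.

End Loop.

(** * The resolvent and stability of block-diagonal systems *)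

Lemma zIsubE n (A : 'M[R]_n) : zIsub A = zeta%:M - rf_mx A.
Proof.
by apply/matrixP => i j; rewrite !mxE tofracB; case: eqP => _; rewrite ?mulr0n ?tofrac0.
Qed.

Lemma zIsub_unit n (A : 'M[R]_n) : zIsub A \in unitmx.
Proof.
rewrite unitmxE /zIsub det_map_mx unitfE tofrac_eq0.
exact: (monic_neq0 (char_poly_monic A)).
Qed.

Lemma zIsub_feedback n m (A : 'M[R]_n) (B : 'M[R]_(n, m)) (F : 'M[R]_(m, n)) :
  zIsub (A + B *m F) = zIsub A - rf_mx B *m rf_mx F.
Proof. by rewrite !zIsubE rf_mxD rf_mxM opprD addrA. Qed.

Lemma zIsub_block n k (A : 'M[R]_n) (Ak : 'M[R]_k) :
  zIsub (block_mx A 0 0 Ak) = block_mx (zIsub A) 0 0 (zIsub Ak).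
Proof.
rewrite !zIsubE rf_mx_block !rf_mx0 (scalar_mx_block n k) opp_block_mx add_block_mx.
by rewrite !subr0.
Qed.

Lemma mval_zIsub n (A : 'M[R]_n) (z : C) :
  mx_has_value (Some z) (zIsub A) (z%:M - cmx A).
Proof.
move=> i j; rewrite /zIsub mxE.
suff -> : (z%:M - cmx A) i j = (toC (char_poly_mx A i j)).[z] by exact: val_poly.
rewrite !mxE rmorphB /= hornerD hornerN map_polyC hornerC /=; congr (_ - _).
by case: eqP => _; rewrite ?mulr1n ?mulr0n ?map_polyX ?hornerX // rmorph0 horner0.
Qed.

Lemma eigenvalue_unitmx n (M : 'M[C]_n) (z : C) :
  eigenvalue M z = (z%:M - M \notin unitmx).
Proof.
rewrite eigenvalue_root_char unitmxE unitfE negbK /root; congr (_ == 0).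
rewrite /char_poly -[RHS]/(\det (z%:M - M)) -horner_evalE -det_map_mx.
congr (\det _); apply/matrixP => i j.
by rewrite !mxE /= /horner_eval hornerD hornerN hornerC hornerMn hornerX.
Qed.

Lemma invmx_unique (F : fieldType) n (M N : 'M[F]_n) :
  M *m N = 1%:M -> invmx M = N.
Proof.
by move=> MN; have [uM _] := mulmx1_unit MN; rewrite -[LHS]mulmx1 -MN mulKmx.
Qed.

Lemma invmx_scalar_sub (F : fieldType) n (x : F) (M : 'M[F]_n) : x != 0 ->
  1%:M - x^-1 *: M \in unitmx ->
  invmx (x%:M - M) = x^-1 *: invmx (1%:M - x^-1 *: M).
Proof.
move=> x0 uM; apply: invmx_unique.
have -> : x%:M - M = x *: (1%:M - x^-1 *: M).
  by rewrite scalerBr scale_scalar_mx mulr1 scalerA divff // scale1r.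
by rewrite -scalemxAl -scalemxAr scalerA divff // scale1r mulmxV.
Qed.

(** The resolvent is z^-1 (I - z^-1 A)^-1, and z^-1 takes the value 0 at infinity. *)
Lemma resolvent_at_infty n (A : 'M[R]_n) :
  mx_has_value None (invmx (zIsub A)) 0.
Proof.
have z0 : zeta != 0 by rewrite tofrac_eq0 polyX_eq0.
have vz : has_value None zeta^-1 0.
  exists 1%N, 1, 'X; rewrite size_poly1 size_polyX; split=> //.
  - by rewrite map_polyX /= coefX oner_eq0.
  - by rewrite tofrac1; rewrite (mul1r (zeta^-1 : ratfun R)).
  - by rewrite rmorph1 map_polyX /= coefX coef1 mul0r.
have vA : mx_has_value None (1%:M - zeta^-1 *: rf_mx A) 1%:M.
  move=> i j; have := valB (mval1 None i j) (valM vz (mval_rf_mx None A i j)).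
  by rewrite mul0r subr0 !mxE.
have [uN vN] := mval_inv vA (@unitmx1 _ _).
have -> : invmx (zIsub A) = zeta^-1 *: invmx (1%:M - zeta^-1 *: rf_mx A).
  by rewrite zIsubE; apply: invmx_scalar_sub.
by move=> i j; have := valM vz (vN i j); rewrite mul0r !mxE.
Qed.

Lemma resolvent_regular n (A : 'M[R]_n) a : stable_mx A -> exterior a ->
  regular a (invmx (zIsub A)).
Proof.
move=> sA; case: a => [z|] /= z1; last by exists 0; apply: resolvent_at_infty.
have u : z%:M - cmx A \in unitmx.
  apply: contraT; rewrite -eigenvalue_unitmx => /sA; by rewrite (le_gtF z1).
by have [_ v] := mval_inv (mval_zIsub A z) u; eexists; apply: v.
Qed.

(** A value M of the resolvent at l satisfies (l - A) M = 1, which excludes l as an eigenvalue. *)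
Lemma resolvent_stable n (A : 'M[R]_n) :
  (forall z : C, 1 <= `|z| -> regular (Some z) (invmx (zIsub A))) -> stable_mx A.
Proof.
move=> rA l; rewrite eigenvalue_unitmx => nu.
rewrite real_ltNge ?normr_real ?real1 //; apply/negP => /rA [M vM].
have := mvalM (mval_zIsub A l) vM; rewrite mulmxV ?zIsub_unit // => v1.
have e1 : (l%:M - cmx A) *m M = 1%:M.
  by apply/matrixP => i j; apply: has_value_unique (v1 i j) (mval1 _ i j).
by have [u _] := mulmx1_unit e1; rewrite u in nu.
Qed.

Lemma invmx_zIsub_block n k (A : 'M[R]_n) (Ak : 'M[R]_k) :
  invmx (zIsub (block_mx A 0 0 Ak)) =
  block_mx (invmx (zIsub A)) 0 0 (invmx (zIsub Ak)).
Proof.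
apply: invmx_unique; rewrite zIsub_block.
rewrite mulmx_block !mul0mx !mulmx0 !mulmxV ?zIsub_unit // !addr0 !add0r.
by rewrite -scalar_mx_block.
Qed.

Lemma stable_block n k (A : 'M[R]_n) (Ak : 'M[R]_k) :
  stable_mx A -> stable_mx Ak -> stable_mx (block_mx A 0 0 Ak).
Proof.
move=> sA sAk; apply: resolvent_stable => z z1; rewrite invmx_zIsub_block.
have r0 m' n' : regular (Some z) (0 : 'M[ratfun R]_(m', n')).
  by rewrite -rf_mx0; apply: reg_rf_mx.
by apply: reg_block; do [exact: r0 | exact: resolvent_regular].
Qed.

Lemma stabilizable_block n k m p (A : 'M[R]_n) (Ak : 'M[R]_k)
    (B : 'M[R]_(n, m)) (Bk : 'M[R]_(k, p)) :
  stabilizable A B -> stabilizable Ak Bk ->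
  stabilizable (block_mx A 0 0 Ak) (block_mx B 0 0 Bk).
Proof.
move=> [F sF] [Fk sFk]; exists (block_mx F 0 0 Fk).
rewrite mulmx_block !mul0mx !mulmx0 add_block_mx !addr0 !add0r.
exact: stable_block.
Qed.

Lemma detectable_block n k m p (A : 'M[R]_n) (Ak : 'M[R]_k)
    (H : 'M[R]_(m, n)) (Hk : 'M[R]_(p, k)) :
  detectable A H -> detectable Ak Hk ->
  detectable (block_mx A 0 0 Ak) (block_mx H 0 0 Hk).
Proof.
move=> [F sF] [Fk sFk]; exists (block_mx F 0 0 Fk).
rewrite mulmx_block !mul0mx !mulmx0 add_block_mx !addr0 !add0r.
exact: stable_block.
Qed.

Lemma stabilizable_feedback n m (A : 'M[R]_n) (B : 'M[R]_(n, m)) X :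
  stabilizable A B -> stabilizable (A + B *m X) B.
Proof. by move=> [F sF]; exists (F - X); rewrite mulmxBr addrA addrAC addrK. Qed.

Lemma detectable_feedback n p (A : 'M[R]_n) (H : 'M[R]_(p, n)) X :
  detectable A H -> detectable (A + X *m H) H.
Proof. by move=> [L sL]; exists (L - X); rewrite mulmxBl addrA addrAC addrK. Qed.

(* With A + B F and A + L H stable, H (z - A)^-1 and then (z - A)^-1 are obtained
   from the transfer matrix by stable operations. *)
Lemma stable_of_transfer n m p (A : 'M[R]_n) (B : 'M[R]_(n, m)) (H : 'M[R]_(p, n)) :
  stabilizable A B -> detectable A H ->
  (forall z : C, 1 <= `|z| ->
     regular (Some z) (rf_mx H *m invmx (zIsub A) *m rf_mx B)) ->
  stable_mx A.
Proof.
move=> [F sF] [L sL] rT; apply: resolvent_stable => z z1.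
set E := zIsub A; have uE : E \in unitmx := zIsub_unit A.
set SF := invmx (zIsub (A + B *m F)); set SL := invmx (zIsub (A + L *m H)).
have rSF : regular (Some z) SF by apply: resolvent_regular.
have rSL : regular (Some z) SL by apply: resolvent_regular.
have EF : invmx E = SF - invmx E *m (rf_mx B *m rf_mx F) *m SF.
  by apply: invmx_rperturb; rewrite // -zIsub_feedback mulmxV ?zIsub_unit.
have EL : invmx E = SL *m (1%:M - rf_mx L *m rf_mx H *m invmx E).
  by apply: invmx_lperturb; rewrite // -zIsub_feedback mulVmx ?zIsub_unit.
have rH : regular (Some z) (rf_mx H *m invmx E).
  rewrite EF mulmxBr; apply: regB; first by apply: regM => //; apply: reg_rf_mx.
  rewrite !mulmxA; apply: regM => //; apply: regM; last exact: reg_rf_mx.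
  exact: rT.
rewrite EL -mulmxA; apply: regM => //; apply: regB; first exact: reg1.
by apply: regM => //; apply: reg_rf_mx.
Qed.

Definition closed_loop_mx n m p k (A : 'M[R]_n) (B : 'M[R]_(n, m)) (H : 'M[R]_(p, n))
    (Ak : 'M[R]_k) (Bk : 'M[R]_(k, p)) (Hk : 'M[R]_(m, k)) (Dk : 'M[R]_(m, p)) :=
  block_mx (A + B *m Dk *m H) (B *m Hk) (Bk *m H) Ak.

(** The interconnection is the static output feedback [Dk 1; 1 0] around plant and controller side
    by side, so stabilizability and detectability are inherited. *)
Lemma closed_loop_mxE n m p k (A : 'M[R]_n) (B : 'M[R]_(n, m)) (H : 'M[R]_(p, n))
    (Ak : 'M[R]_k) (Bk : 'M[R]_(k, p)) (Hk : 'M[R]_(m, k)) (Dk : 'M[R]_(m, p)) :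
  closed_loop_mx A B H Ak Bk Hk Dk =
  block_mx A 0 0 Ak + block_mx B 0 0 Bk *m block_mx Dk 1%:M 1%:M 0 *m block_mx H 0 0 Hk.
Proof.
rewrite !mulmx_block !mul0mx !mulmx0 !mulmx1 !addr0 !add0r !mul0mx add_block_mx.
by rewrite !addr0 !add0r.
Qed.

(** Through [feedback_solve] and K0 = K - Dk, the four closed-loop maps determine the transfer
    matrix of the whole loop, to which [stable_of_transfer] applies. *)
Lemma closed_loop_stable n m p k (A : 'M[R]_n) (B : 'M[R]_(n, m)) (H : 'M[R]_(p, n))
    (Ak : 'M[R]_k) (Bk : 'M[R]_(k, p)) (Hk : 'M[R]_(m, k)) (Dk : 'M[R]_(m, p))
    (V : 'M[ratfun R]_p) :
  let G := transfer A B H 0 in let K := transfer Ak Bk Hk Dk in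
  stabilizable A B -> detectable A H -> stabilizable Ak Bk -> detectable Ak Hk ->
  V *m (1%:M - G *m K) = 1%:M ->
  (forall z : C, 1 <= `|z| -> [/\ regular (Some z) V, regular (Some z) (K *m V),
     regular (Some z) (V *m G) & regular (Some z) (K *m V *m G)]) ->
  stable_mx (closed_loop_mx A B H Ak Bk Hk Dk).
Proof.
move=> G K sA dA sAk dAk VE rV.
have cl := closed_loop_mxE A B H Ak Bk Hk Dk.
set A0 := block_mx A 0 0 Ak in cl; set B0 := block_mx B 0 0 Bk in cl.
set H0 := block_mx H 0 0 Hk in cl; set D0 := block_mx Dk 1%:M 1%:M 0 in cl.
apply: (@stable_of_transfer _ _ _ _ B0 H0).
- by rewrite cl -mulmxA; apply/stabilizable_feedback/stabilizable_block.
- by rewrite cl; apply/detectable_feedback/detectable_block.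
set K0 := rf_mx Hk *m invmx (zIsub Ak) *m rf_mx Bk.
have T0E : rf_mx H0 *m invmx (zIsub A0) *m rf_mx B0 = block_mx G 0 0 K0.
  rewrite !rf_mx_block !rf_mx0 invmx_zIsub_block.
  rewrite !mulmx_block !mul0mx !mulmx0 !addr0 !add0r !mul0mx.
  by rewrite /G /transfer rf_mx0 addr0.
have KK0 : K0 = K - rf_mx Dk by rewrite /K /transfer addrK.
have cl0 : zIsub (closed_loop_mx A B H Ak Bk Hk Dk) =
    zIsub A0 - rf_mx B0 *m rf_mx D0 *m rf_mx H0.
  by rewrite cl -mulmxA zIsub_feedback rf_mxM mulmxA.
have D0E : rf_mx D0 = block_mx (rf_mx Dk) 1%:M 1%:M 0.
  by rewrite rf_mx_block !rf_mx1 rf_mx0.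
pose T := rf_mx H0 *m invmx (zIsub (closed_loop_mx A B H Ak Bk Hk Dk)) *m rf_mx B0.
have TE : T = block_mx G 0 0 K0 +
    block_mx G 0 0 K0 *m block_mx (rf_mx Dk) 1%:M 1%:M 0 *m T.
  rewrite -D0E; exact: feedback_transfer (zIsub_unit _) (zIsub_unit _) cl0 T0E.
move=> z z1; rewrite -/T.
have {}VE : V *m (1%:M - G *m (K0 + rf_mx Dk)) = 1%:M by rewrite KK0 subrK.
rewrite (feedback_solve VE TE).
have [rV1 rKV rVG rKVG] := rV z z1.
have rD : regular (Some z) (rf_mx Dk) by apply: reg_rf_mx.
have rK0V : regular (Some z) (K0 *m V).
  by rewrite KK0 mulmxBl; apply: regB => //; apply: regM.
have rK0VG : regular (Some z) (K0 *m V *m G).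
  by rewrite KK0 !mulmxBl -(mulmxA (rf_mx Dk)); apply: regB => //; apply: regM.
apply: reg_block => //.
  by apply: regB; [apply: regB => //; apply: reg1 | apply: regM].
by apply: regB => //; apply: regM.
Qed.

End StateSpaceRegularity.

(** * Convergence of the closed-loop trajectories *)

Section AsymptoticStability.
Variable R : realType.
Local Notation C := R[i].
Local Notation cmx := (map_mx (real_complex R)).

Definition vanishes (s : nat -> C) : Prop :=
  forall e : C, 0 < e -> exists N, forall t, (N <= t)%N -> `|s t| <= e.

Lemma vanishes_recurrence (l : C) (s : nat -> C) : `|l| < 1 ->
  vanishes (fun t => s t.+1 - l * s t) -> vanishes s.
Proof.
move=> l1 sl e e0; set rho := `|l|; have rho0 : 0 <= rho by rewrite /rho.
have e2 : 0 < e / 2 by rewrite divr_gt0.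
(* With this error term e / 2 is the fixed point of a -> rho a + error, whence |s (N + k)| <= rho^k
   |s N| + e / 2. *)
have d0 : 0 < e / 2 * (1 - rho) by rewrite mulr_gt0 // subr_gt0.
have [N sN] := sl _ d0.
have bd k : `|s (N + k)%N| <= rho ^+ k * `|s N| + e / 2.
  elim: k => [|k IH]; first by rewrite addn0 expr0 mul1r lerDl ltW.
  rewrite addnS -[s _](subrK (l * s (N + k)%N)); apply: le_trans (ler_normD _ _) _.
  apply: le_trans (lerD (sN _ (leq_addr _ _))
    (_ : _ <= rho * (rho ^+ k * `|s N| + e / 2))) _.
    by rewrite normrM ler_wpM2l.
  by rewrite le_eqVlt; apply/orP; left; apply/eqP; rewrite exprS; ring.
have K0 : 0 < `|s N| + 1 by rewrite ltr_wpDl.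
have [M rM] := expr_small rho0 l1 (divr_gt0 e2 K0).
exists (N + M.+1)%N => t Nt; rewrite -(subnKC (leq_trans (leq_addr _ _) Nt)).
apply: le_trans (bd _) _; rewrite [leRHS]splitr lerD2r.
apply: le_trans (_ : e / 2 / (`|s N| + 1) * (`|s N| + 1) <= _);
  last by rewrite divfK // gt_eqF.
apply: ler_pM => //; first by rewrite exprn_ge0.
  by apply: le_trans rM; apply: ler_wiXn2l => //; [exact: ltW | lia].
by rewrite lerDl.
Qed.

(* Cayley-Hamilton: the trajectory is annihilated by a product of operators
   (shift - l) with |l| < 1. *)
Lemma powers_vanish n (A : 'M[C]_n) (x : nat -> 'cV[C]_n) :
  (forall l, eigenvalue A l -> `|l| < 1) ->
  (forall t, x t.+1 = A *m x t) -> forall i, vanishes (fun t => x t i 0).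
Proof.
(* Cayley-Hamilton is applied in positive dimension; in dimension 0 there is no coordinate. *)
case: n A x => [|n] A x Al xA; first by case.
have [rs rsE] := closed_field_poly_normal (char_poly A).
rewrite (monicP (char_poly_monic A)) scale1r in rsE.
have rs1 l : l \in rs -> `|l| < 1.
  by move=> lrs; apply: Al; rewrite eigenvalue_root_char rsE root_prod_XsubC.
have : forall t, horner_mx A (\prod_(l <- rs) ('X - l%:P)) *m x t = 0.
  by move=> t; rewrite -rsE Cayley_Hamilton mul0mx.
elim: rs x xA rs1 {rsE} => [|l rs IH] x xA rs1 xz i.
  move=> e e0; exists 0%N => t _; have := xz t.
  by rewrite big_nil rmorph1 mul1mx => ->; rewrite mxE normr0 ltW.
(* A - l commutes with A, so y is again a trajectory of A, annihilated by the remaining factors. *)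
pose y t := (A - l%:M) *m x t.
apply: (@vanishes_recurrence l); first by rewrite rs1 ?mem_head.
have yE t : y t i 0 = x t.+1 i 0 - l * x t i 0.
  by rewrite /y mulmxBl mul_scalar_mx -xA !mxE.
have : vanishes (fun t => y t i 0).
  apply: IH => [t|l' l'rs|t].
  - by rewrite /y xA !mulmxA mulmxBl mulmxBr scalar_mxC.
  - by rewrite rs1 // in_cons l'rs orbT.
  - have := xz t; rewrite big_cons mulrC rmorphM /= -mulmxE -mulmxA => <-.
    by rewrite rmorphB /= horner_mx_X horner_mx_C.
by move=> yv e /yv [N Ny]; exists N => t /Ny; rewrite yE.
Qed.

Import numFieldNormedType.Exports.
Local Open Scope classical_set_scope.

Lemma stable_mx_cvg n (A : 'M[R]_n) (x : nat -> 'cV[R]_n) : stable_mx A ->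
  (forall t, x t.+1 = A *m x t) -> forall i, (fun t => x t i 0) @ \oo --> (0 : R).
Proof.
move=> sA xA i; have cxA t : cmx (x t.+1) = cmx A *m cmx (x t) by rewrite xA map_mxM.
have xv := powers_vanish sA cxA i.
apply/cvgrPdist_le => e e0.
have e0' : 0 < e%:C%C by rewrite ltcR.
have [N Nx] := xv _ e0'; exists N => // t /= Nt.
have := Nx t Nt; rewrite mxE sub0r normrN -lecR; apply: le_trans.
by rewrite normc_def /= expr0n addr0 sqrtr_sqr.
Qed.

Lemma cvg_cV n (x : nat -> 'cV[R]_n) :
  (forall i, (fun t => x t i 0) @ \oo --> (0 : R)) -> x @ \oo --> (0 : 'cV[R]_n).
Proof.
move=> xc; apply/cvgrPdist_le => e e0.
have /filter_forall : forall i, \forall t \near \oo, `|x t i 0| <= e.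
  move=> i; have /cvgrPdist_le/(_ _ e0) := xc i.
  by apply: filterS => t; rewrite sub0r normrN.
apply: filterS => t xt; rewrite sub0r normrN [leLHS](mx_normrE (x t)).
by apply: bigmax_le => [|[i j] _]; [exact: ltW | rewrite ord1 /=].
Qed.

Section ClosedLoop.
Variables (n m p k : nat) (A : 'M[R]_n) (B : 'M[R]_(n, m)) (H : 'M[R]_(p, n)).
Variables (Ak : 'M[R]_k) (Bk : 'M[R]_(k, p)) (Hk : 'M[R]_(m, k)) (Dk : 'M[R]_(m, p)).

Lemma closed_loop_asymptotic :
  stable_mx (closed_loop_mx A B H Ak Bk Hk Dk) ->
  asymptotically_stable A B H Ak Bk Hk Dk.
Proof.
move=> sM x y xi u cl; pose s t := col_mx (x t) (xi t).
have sE t : s t.+1 = closed_loop_mx A B H Ak Bk Hk Dk *m s t.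
  have [xS yE xiS uE] := cl t.
  rewrite /s /closed_loop_mx mul_block_col xS xiS uE yE !addr0.
  by rewrite !mulmxDr mulmxDl !mulmxA addrA addrAC [_ + Ak *m _]addrC.
have sc := stable_mx_cvg sM sE.
split; apply: cvg_cV => i.
  have := sc (lshift _ i); apply: cvg_trans; apply: near_eq_cvg.
  by near=> t; rewrite col_mxEu.
have := sc (rshift _ i); apply: cvg_trans; apply: near_eq_cvg.
by near=> t; rewrite col_mxEd.
Unshelve. all: by end_near.
Qed.

(** The plant has no direct term: y is read from x, then u from y and xi, so there is no algebraic
    loop. *)
Lemma strictly_proper_well_posed : well_posed A B H Ak Bk Hk Dk.
Proof.
move=> x0 xi0 dx dy du.
pose y_ t (x : 'cV[R]_n) := H *m x + dy t.
pose u_ t x (xi : 'cV[R]_k) := Hk *m xi + Dk *m y_ t x + du t.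
pose st := fix st t := if t is t'.+1 then let: (x, xi) := st t' in
  (A *m x + B *m u_ t' x xi + dx t', Ak *m xi + Bk *m y_ t' x) else (x0, xi0).
pose x t := (st t).1; pose xi t := (st t).2.
exists (x, fun t => y_ t (x t), xi, fun t => u_ t (x t) (xi t)); split.
  by split=> // t; split=> //; rewrite /x /xi /=; case: (st t).
case=> [[[x' y'] xi'] u'] [x'0 xi'0 cl].
have yE t : y' t = y_ t (x' t) by have [] := cl t.
have uE t : u' t = u_ t (x' t) (xi' t) by have [_ yt _ ->] := cl t; rewrite yt.
have e t : x t = x' t /\ xi t = xi' t.
  elim: t => [|t [xt xit]]; first by rewrite x'0 xi'0.
  have [-> _ -> _] := cl t; rewrite uE yE -xt -xit.
  by rewrite /x /xi /=; case: (st t).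
have ex : x = x' by apply/funext => t; have [] := e t.
have exi : xi = xi' by apply/funext => t; have [] := e t.
congr (_, _, _, _) => //; apply/funext => t.
  by rewrite yE ex.
by rewrite uE ex exi.
Qed.

End ClosedLoop.
End AsymptoticStability.

(** * Robust stability from the residual *)

Section Robustness.
Variable R : realType.
Local Notation C := R[i].

Lemma hinf_norm_lt1 m n (F : 'M[ratfun R]_(m, n)) : (hinf_norm F < 1)%E ->
  exists r : R, [/\ 0 < r, r < 1 & (hinf_norm F <= r%:E)%E].
Proof.
have := hinf_norm_ge0 F; case: (hinf_norm F) => [h| |] // h0 h1.
rewrite lee_fin in h0; rewrite lte_fin in h1.
(* The midpoint stays positive when the norm is 0; [gain_quadratic] divides by r. *)
by exists ((h + 1) / 2); split; rewrite ?lee_fin; lra.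
Qed.

(** The quotient lives in the extended reals: an infinite norm of F makes it 0, which is impossible,
    and a zero norm makes it infinite, where a = 0 serves. *)
Lemma hinf_norm_product_lt1 m n p q (F : 'M[ratfun R]_(m, n))
    (G : 'M[ratfun R]_(p, q)) :
  (hinf_norm G < 1 / hinf_norm F)%E ->
  exists a b : R, [/\ 0 <= a, 0 <= b, a * b < 1, (hinf_norm F <= a%:E)%E &
                  (hinf_norm G <= b%:E)%E].
Proof.
have := hinf_norm_ge0 F; have := hinf_norm_ge0 G.
case: (hinf_norm G) => [b| |] //; last by move=> _ _; rewrite ltNge leey.
rewrite lee_fin => b0; case: (hinf_norm F) => [a| |] // a0; last first.
  by rewrite invey mule0 lte_fin ltNge b0.
rewrite lee_fin in a0; move: a0; rewrite le_eqVlt => /predU1P [<- _|a0].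
  exists 0, b; by rewrite mul0r.
rewrite inver gt_eqF // mul1e lte_fin => ba.
exists a, b; split=> //; first exact: ltW.
by rewrite mulrC -ltr_pdivlMr // mul1r.
Qed.

Lemma proper_internally_stabilizes n m p (A : 'M[R]_n) (B : 'M[R]_(n, m))
    (H : 'M[R]_(p, n)) (K : 'M[ratfun R]_(m, p)) (V : 'M[ratfun R]_p) :
  let G := transfer A B H 0 in
  stabilizable A B -> detectable A H -> proper_mx K ->
  V *m (1%:M - G *m K) = 1%:M ->
  (forall z : C, 1 <= `|z| -> [/\ regular (Some z) V, regular (Some z) (K *m V),
     regular (Some z) (V *m G) & regular (Some z) (K *m V *m G)]) ->
  internally_stabilizes A B H K.
Proof.
move=> G sA dA pK VE rV; split=> // k Ak Bk Hk Dk sAk dAk KE; split.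
  exact: strictly_proper_well_posed.
apply: closed_loop_asymptotic; apply: (closed_loop_stable (V := V)) => //.
  by rewrite KE.
by rewrite KE.
Qed.

Lemma small_gain_inv n (F : 'M[ratfun R]_n) (r : R) :
  RHinf F -> 0 < r -> r < 1 ->
  (forall z M, `|z| = 1 -> mx_has_value (Some z) F M -> gain_le r%:C%C M) ->
  1%:M + F \in unitmx /\ (forall a, exterior a -> regular a (invmx (1%:M + F))).
Proof.
move=> RF r0 r1 Fr.
have r0' : 0 < r%:C%C :> C by rewrite ltcR.
have r1' : r%:C%C < 1 :> C by rewrite ltcR.
have key a : exterior a -> 1%:M + F \in unitmx /\ regular a (invmx (1%:M + F)).
  move=> ea; have /RHinfP/(_ a ea) [M FM] := RF.
  have uM := small_gain RF r0' r1' Fr ea FM.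
  have [u v] := mval_inv (mvalD (@mval1 R a n) FM) uM.
  by split=> //; exists (invmx (1%:M + M)).
by split=> [|a /key []//]; have [] := key None I.
Qed.

Section Field.
Variable F : fieldType.

Lemma loop_identity n m (G : 'M[F]_(n, m)) (U : 'M[F]_(m, n)) (Y W : 'M[F]_n) :
  Y - G *m U = W -> W \in unitmx -> Y \in unitmx ->
  Y *m invmx W *m (1%:M - G *m (U *m invmx Y)) = 1%:M.
Proof.
move=> YE uW uY.
have -> : 1%:M - G *m (U *m invmx Y) = W *m invmx Y.
  by rewrite -YE mulmxBl mulmxV // mulmxA.
by rewrite mulmxA mulmxKV // mulmxV.
Qed.

Lemma state_feedback_identity n m (Z : 'M[F]_n) (B : 'M[F]_(n, m))
    (U : 'M[F]_(m, n)) (X W : 'M[F]_n) :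
  Z *m X - B *m U = W -> W \in unitmx -> X \in unitmx -> Z \in unitmx ->
  X *m (invmx W *m Z) *m (1%:M - invmx Z *m B *m (U *m invmx X)) = 1%:M.
Proof.
move=> XE uW uX uZ.
have e : Z *m (1%:M - invmx Z *m B *m (U *m invmx X)) = W *m invmx X.
  by rewrite -XE mulmxBr mulmx1 mulmxBl mulmxK // !mulmxA mulmxV // mul1mx.
by rewrite -(mulmxA X) -(mulmxA (invmx W)) e mulKmx // mulmxV.
Qed.

End Field.

(** Common core of the two stable-plant cases: Y is Fyy, or I + C Fxy with D = C (zI - A)^-1 D2. The
    gain is assumed on the values of D, so a bound on the factors suffices. *)
Lemma residual_stabilizes n m p (A : 'M[R]_n) (B : 'M[R]_(n, m)) (H : 'M[R]_(p, n))
    (Y : 'M[ratfun R]_p) (U : 'M[ratfun R]_(m, p)) (D : 'M[ratfun R]_p) (r : R) :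
  stabilizable A B -> detectable A H -> stable_mx A -> RHinf Y -> RHinf U ->
  Y - transfer A B H 0 *m U = 1%:M + D -> 0 < r -> r < 1 ->
  (forall z M, `|z| = 1 -> mx_has_value (Some z) D M -> gain_le r%:C%C M) ->
  Y \in unitmx /\ internally_stabilizes A B H (U *m invmx Y).
Proof.
set G := transfer A B H 0; move=> sA dA stA /RHinfP RY /RHinfP RU YE r0 r1 Dr.
have rP a : exterior a -> regular a (invmx (zIsub A)) by exact: resolvent_regular.
have rG a : exterior a -> regular a G.
  move=> ea; apply: regD; last exact: reg_rf_mx.
  by apply: regM; last exact: reg_rf_mx; apply: regM; [exact: reg_rf_mx | exact: rP].
have G0 : mx_has_value None G 0.
  have := mvalD (mvalM (mvalM (mval_rf_mx None H) (resolvent_at_infty A))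
    (mval_rf_mx None B)) (mval_rf_mx None 0).
  by rewrite mulmx0 mul0mx add0r map_mx0.
have DE : D = Y - G *m U - 1%:M by rewrite YE addrC addKr.
have RD : RHinf D.
  apply/RHinfP => a ea; rewrite DE; apply: regB; last exact: reg1.
  by apply: regB; [exact: RY | apply: regM; [exact: rG | exact: RU]].
have [uW rW] := small_gain_inv RD r0 r1 Dr.
(* At infinity G is 0 and Y takes the value of I + D, invertible by [small_gain]; properness of K
   follows as well. *)
have [uY rY] : Y \in unitmx /\ regular None (invmx Y).
  have /RHinfP/(_ None I) [M DM] := RD; have [N UN] := RU None I.
  have vY : mx_has_value None Y (1%:M + M + 0 *m N).
    have -> : Y = 1%:M + D + G *m U by rewrite -YE subrK.
    by apply: mvalD; [apply: mvalD => //; apply: mval1 | apply: mvalM].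
  rewrite mul0mx addr0 in vY.
  have r0' : 0 < r%:C%C :> C by rewrite ltcR.
  have r1' : r%:C%C < 1 :> C by rewrite ltcR.
  have uM := @small_gain _ _ _ _ RD r0' r1' Dr None M I DM.
  by have [u v] := mval_inv vY uM; split=> //; exists (invmx (1%:M + M)).
split=> //.
apply: (proper_internally_stabilizes (V := Y *m invmx (1%:M + D))) => //.
- by apply/proper_mxP; apply: regM => //; apply: RU.
- exact: (loop_identity YE uW uY).
- move=> z z1; have rWz := rW (Some z) z1.
  have rGz := rG (Some z) z1; have rYz := RY (Some z) z1; have rUz := RU (Some z) z1.
  (* Y^-1 may be unstable, but it cancels: the four maps involve only Y, U, G and (I + D)^-1. *)
  have KV : U *m invmx Y *m (Y *m invmx (1%:M + D)) = U *m invmx (1%:M + D).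
    by rewrite mulmxA mulmxKV.
  by rewrite KV; split; apply: regM => //; apply: regM.
Qed.

(** The factor zI - A of V cancels the resolvent in V G and K V G, so A may be unstable. The
    equation forces X to vanish at infinity, and properness of K cannot be inferred: A = 0, B = 1, X
    = 3 / (2 z), U = 1 / 2, D = 0 give K = z / 3. *)
Lemma state_feedback_stabilizes n m (A : 'M[R]_n) (B : 'M[R]_(n, m))
    (X : 'M[ratfun R]_n) (U : 'M[ratfun R]_(m, n)) (D : 'M[ratfun R]_n) (r : R) :
  stabilizable A B -> detectable A (1%:M : 'M[R]_n) -> RHinf X -> RHinf U -> RHinf D ->
  X \in unitmx -> proper_mx (U *m invmx X) ->
  zIsub A *m X - rf_mx B *m U = 1%:M + D -> 0 < r -> r < 1 ->
  (forall z M, `|z| = 1 -> mx_has_value (Some z) D M -> gain_le r%:C%C M) ->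
  internally_stabilizes A B (1%:M : 'M[R]_n) (U *m invmx X).
Proof.
move=> sA dA /RHinfP RX /RHinfP RU RD uX pK XE r0 r1 Dr.
have [uW rW] := small_gain_inv RD r0 r1 Dr.
have uZ := zIsub_unit A.
have GE : transfer A B 1%:M 0 = invmx (zIsub A) *m rf_mx B.
  by rewrite /transfer rf_mx1 mul1mx rf_mx0 addr0.
apply: (proper_internally_stabilizes
  (V := X *m (invmx (1%:M + D) *m zIsub A))) => //; rewrite GE.
  exact: (state_feedback_identity XE uW uX uZ).
move=> z z1; have rWz := rW (Some z) z1.
have rXz := RX (Some z) z1; have rUz := RU (Some z) z1.
have rB : regular (Some z) (rf_mx B) by apply: reg_rf_mx.
have rZ : regular (Some z) (zIsub A) by eexists; apply: mval_zIsub.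
have KV : U *m invmx X *m (X *m (invmx (1%:M + D) *m zIsub A)) =
    U *m (invmx (1%:M + D) *m zIsub A).
  by rewrite [LHS]mulmxA (mulmxKV uX).
have ZG l (Q : 'M[ratfun R]_(l, n)) :
    Q *m (invmx (1%:M + D) *m zIsub A) *m (invmx (zIsub A) *m rf_mx B) =
    Q *m (invmx (1%:M + D) *m rf_mx B).
  by rewrite -(mulmxA Q) -(mulmxA (invmx (1%:M + D))) (mulKVmx uZ).
by rewrite KV (ZG _ X) (ZG _ U); split; apply: regM => //; apply: regM.
Qed.

End Robustness.

(** * From the residual equations to the three cases *)

Lemma iop_residual1 (R : realType) m p (G : 'M[ratfun R]_(p, m))
    Fyy Fyu Fuy Fuu D1 D2 D3 D4 :
  iop_residuals G Fyy Fyu Fuy Fuu D1 D2 D3 D4 -> Fyy - G *m Fuy = 1%:M + D1.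
Proof.
by case; rewrite mul_row_block => /eq_row_mx [<- _] _; rewrite mul1mx mulNmx.
Qed.

Lemma slp_residual12 (R : realType) n m p (A : 'M[R]_n) (B : 'M[R]_(n, m))
    (H : 'M[R]_(p, n)) Fxx Fxy Fux Fuy D1 D2 D3 D4 :
  slp_residuals A B H Fxx Fxy Fux Fuy D1 D2 D3 D4 ->
  zIsub A *m Fxx - rf_mx B *m Fux = 1%:M + D1 /\
  zIsub A *m Fxy - rf_mx B *m Fuy = D2.
Proof. by case; rewrite mul_row_block !mulNmx => /eq_row_mx [<- <-] _. Qed.

(** Multiplying the residual equation on the left by H Z^-1 brings it to the form that
    [residual_stabilizes] expects. *)
Lemma output_residual (F : fieldType) n m p (Z : 'M[F]_n) (B : 'M[F]_(n, m))
    (H : 'M[F]_(p, n)) (X : 'M[F]_(n, p)) (U : 'M[F]_(m, p)) (D : 'M[F]_(n, p)) :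
  Z \in unitmx -> Z *m X - B *m U = D ->
  1%:M + H *m X - (H *m invmx Z *m B) *m U = 1%:M + H *m invmx Z *m D.
Proof.
move=> uZ <-; rewrite mulmxBr !mulmxA mulmxKV // addrA; congr (_ - _).
Qed.

Lemma product_gain (R : realType) m n p (F : 'M[ratfun R]_(m, n))
    (G : 'M[ratfun R]_(n, p)) (a b : R) z M :
  RHinf F -> RHinf G -> 0 <= a -> `|z| = 1 ->
  (hinf_norm F <= a%:E)%E -> (hinf_norm G <= b%:E)%E ->
  mx_has_value (Some z) (F *m G) M -> gain_le (a * b)%:C%C M.
Proof.
move=> /RHinfP RF /RHinfP RG a0 z1 Fa Gb FGM.
have ez : exterior (Some z) by rewrite /= z1.
have [M1 FM1] := RF _ ez; have [M2 GM2] := RG _ ez.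
have -> : M = M1 *m M2.
  by apply/matrixP => i j; apply: has_value_unique (FGM i j) (mvalM FM1 GM2 i j).
rewrite rmorphM /=; apply: gain_leM; first by rewrite lecR.
- exact: hinf_gain Fa z1 FM1.
- exact: hinf_gain Gb z1 GM2.
Qed.

Theorem corollary6 (R : realType) :
  (forall (n m p : nat) (A : 'M[R]_n) (B : 'M[R]_(n, m)) (C : 'M[R]_(p, n))
      (Fyy : 'M[ratfun R]_(p, p)) (Fyu : 'M[ratfun R]_(p, m))
      (Fuy : 'M[ratfun R]_(m, p)) (Fuu : 'M[ratfun R]_(m, m))
      (D1 : 'M[ratfun R]_(p, p)) (D2 : 'M[ratfun R]_(p, m))
      (D3 : 'M[ratfun R]_(p, m)) (D4 : 'M[ratfun R]_(m, m)),
    stabilizable A B -> detectable A C ->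
    RHinf Fyy -> RHinf Fuy -> RHinf Fyu -> RHinf Fuu ->
    iop_residuals (transfer A B C 0) Fyy Fyu Fuy Fuu D1 D2 D3 D4 ->
    stable_mx A ->
    (hinf_norm D1 < 1)%E ->
    Fyy \in unitmx /\ internally_stabilizes A B C (Fuy *m invmx Fyy))
  /\
  (forall (n m : nat) (A : 'M[R]_n) (B : 'M[R]_(n, m)) (C : 'M[R]_n)
      (Fxx : 'M[ratfun R]_(n, n)) (Fxy : 'M[ratfun R]_(n, n))
      (Fux : 'M[ratfun R]_(m, n)) (Fuy : 'M[ratfun R]_(m, n))
      (D1 : 'M[ratfun R]_(n, n)) (D2 : 'M[ratfun R]_(n, n))
      (D3 : 'M[ratfun R]_(n, n)) (D4 : 'M[ratfun R]_(m, n)),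
    stabilizable A B -> detectable A C ->
    RHinf Fxx -> RHinf Fux -> RHinf Fxy -> RHinf Fuy ->
    slp_residuals A B C Fxx Fxy Fux Fuy D1 D2 D3 D4 ->
    C = 1%:M ->
    (* the formula for K defines a controller *)
    Fxx \in unitmx -> proper_mx (Fux *m invmx Fxx) ->
    RHinf D1 -> (hinf_norm D1 < 1)%E ->
    internally_stabilizes A B C (Fux *m invmx Fxx))
  /\
  (forall (n m p : nat) (A : 'M[R]_n) (B : 'M[R]_(n, m)) (C : 'M[R]_(p, n))
      (Fxx : 'M[ratfun R]_(n, n)) (Fxy : 'M[ratfun R]_(n, p))
      (Fux : 'M[ratfun R]_(m, n)) (Fuy : 'M[ratfun R]_(m, p))
      (D1 : 'M[ratfun R]_(n, n)) (D2 : 'M[ratfun R]_(n, p))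
      (D3 : 'M[ratfun R]_(n, n)) (D4 : 'M[ratfun R]_(m, n)),
    stabilizable A B -> detectable A C ->
    RHinf Fxx -> RHinf Fux -> RHinf Fxy -> RHinf Fuy ->
    slp_residuals A B C Fxx Fxy Fux Fuy D1 D2 D3 D4 ->
    stable_mx A ->
    RHinf D2 ->
    (* strict: with equality allowed the claim fails, e.g. A = 0, B = C = 1,
       Fxy = -1/(2z), Fuy = 1/2, D2 = -1, where the closed loop has a pole at 1 *)
    (hinf_norm D2 < 1 / hinf_norm (rf_mx C *m invmx (zIsub A)))%E ->
    (1%:M + rf_mx C *m Fxy) \in unitmx /\
    internally_stabilizes A B C (Fuy *m invmx (1%:M + rf_mx C *m Fxy))).
Proof.
split; last split.
- move=> n m p A B C Fyy Fyu Fuy Fuu D1 D2 D3 D4 sA dA RYY RUY _ _ res stA D1lt.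
  have [r [r0 r1 D1r]] := hinf_norm_lt1 D1lt.
  apply: (residual_stabilizes sA dA stA RYY RUY (iop_residual1 res) r0 r1).
  by move=> z M; apply: hinf_gain.
- move=> n m A B C Fxx Fxy Fux Fuy D1 D2 D3 D4 sA dA RXX RUX _ _ res CE uX pK RD D1lt.
  subst C; have [r [r0 r1 D1r]] := hinf_norm_lt1 D1lt.
  apply: (state_feedback_stabilizes sA dA RXX RUX RD uX pK
    (slp_residual12 res).1 r0 r1).
  by move=> z M; apply: hinf_gain.
- move=> n m p A B C Fxx Fxy Fux Fuy D1 D2 D3 D4 sA dA _ _ RXY RUY res stA RD D2lt.
  have [a [b [a0 b0 ab CPa D2b]]] := hinf_norm_product_lt1 D2lt.
  (* Again the midpoint below 1, positive even when a b = 0. *)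
  have r0 : 0 < (a * b + 1) / 2 by have := mulr_ge0 a0 b0; lra.
  have r1 : (a * b + 1) / 2 < 1 by lra.
  have RCP : RHinf (rf_mx C *m invmx (zIsub A)).
    apply/RHinfP => q eq_; apply: regM; first exact: reg_rf_mx.
    exact: resolvent_regular.
  have RY : RHinf (1%:M + rf_mx C *m Fxy).
    apply/RHinfP => q eq_; apply: regD; first exact: reg1.
    by apply: regM; [exact: reg_rf_mx | move/RHinfP: RXY; apply].
  have YE := output_residual (rf_mx C) (zIsub_unit A) (slp_residual12 res).2.
  (* [transfer] carries a zero direct term, inserted here to match it. *)
  rewrite -[X in _ - X *m _]addr0 -(rf_mx0 R p m) in YE.
  apply: (residual_stabilizes sA dA stA RY RUY YE r0 r1) => z M z1 DM.
  apply: (@gain_le_mono _ (a * b)%:C%C).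
  + by rewrite lecR mulr_ge0.
  + by rewrite lecR; lra.
  + exact: product_gain RCP RD a0 z1 CPa D2b DM.
Qed.
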